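(* Let $f(z)=z+\sum_{n=2}^{\infty}a_nz^n\in\mathcal{S}^{*}_{\rho}$. Then $$|H_{4,1}(f)|\le 0.428001,\qquad\text{where}\quad H_{4,1}(f)=\det\begin{pmatrix}1&a_2&a_3&a_4\\ a_2&a_3&a_4&a_5\\ a_3&a_4&a_5&a_6\\ a_4&a_5&a_6&a_7\end{pmatrix}.$$
   Context: Let $\mathbb{D}=\{z\in\mathbb{C}:|z|<1\}$. For analytic $g_1,g_2$ on $\mathbb{D}$, $g_1\prec g_2$ means there is an analytic $w:\mathbb{D}\to\mathbb{D}$ with $w(0)=0$ such that $g_1=g_2\circ w$. Here $\sinh^{-1}$ denotes the principal branch of the inverse hyperbolic sine with $\sinh^{-1}(0)=0$, analytic on $\mathbb{D}$. The class $\mathcal{S}^{*}_{\rho}$ consists of all univalent analytic functions $f$ on $\mathbb{D}$ with $f(z)=z+\sum_{n\ge2}a_nz^n$ such that $\frac{zf'(z)}{f(z)}\prec 1+\sinh^{-1}(z)$. *)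

(* Defs.v *)
From Stdlib Require Import Reals.
From Coquelicot Require Import Coquelicot.
From mathcomp Require Import all_boot all_algebra complex.
From mathcomp Require Import Rstruct.

Set Implicit Arguments.
Unset Strict Implicit.
Unset Printing Implicit Defensive.

Definition in_disk (z : C) : Prop := (Cmod z < 1)%R.

Definition holomorphic_on_disk (f : C -> C) : Prop :=
  forall z : C, in_disk z -> @ex_derive C_AbsRing C_NormedModule f z.

Definition cexp (z : C) : C :=
  (exp (fst z) * cos (snd z), exp (fst z) * sin (snd z))%R.
Definition csinh (z : C) : C :=
  Cmult (Cminus (cexp z) (cexp (Copp z))) (Cinv (RtoC 2)).

(* g is the principal branch of sinh^{-1} on D: the analytic function on D
   with g(0) = 0 and sinh (g z) = z for all z in D (it exists and is unique,
   D being simply connected and sinh'(0) <> 0). *)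
Definition is_principal_asinh (g : C -> C) : Prop :=
  holomorphic_on_disk g /\ g (RtoC 0) = RtoC 0 /\
  forall z : C, in_disk z -> csinh (g z) = z.

Definition subordinate (g1 g2 : C -> C) : Prop :=
  exists w : C -> C, holomorphic_on_disk w /\ w (RtoC 0) = RtoC 0 /\
    (forall z, in_disk z -> in_disk (w z)) /\
    (forall z, in_disk z -> g1 z = g2 (w z)).

Definition univalent_on_disk (f : C -> C) : Prop :=
  forall z1 z2 : C, in_disk z1 -> in_disk z2 -> f z1 = f z2 -> z1 = z2.

(* f belongs to S*_rho, where a is its Taylor coefficient sequence:
   f(z) = z + sum_{n>=2} a_n z^n on D (a_0 = 0, a_1 = 1), f univalent on D,
   and z f'(z)/f(z) < 1 + g(z), g the principal sinh^{-1}.  Since f(0) = 0,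
   z f'(z)/f(z) is understood (as usual) with its removable value 1 at 0;
   the function z f'(z)/f(z) on D is thus phi with z f'(z) = f(z) phi(z),
   phi(0) = 1. *)
Definition in_S_rho (g : C -> C) (f : C -> C) (a : nat -> C) : Prop :=
  a 0%nat = RtoC 0 /\ a 1%nat = RtoC 1 /\
  (forall z, in_disk z -> @is_pseries C_AbsRing C_NormedModule a z (f z)) /\
  univalent_on_disk f /\
  exists phi : C -> C,
    holomorphic_on_disk phi /\ phi (RtoC 0) = RtoC 1 /\
    (forall z d, in_disk z -> @is_derive C_AbsRing C_NormedModule f z d ->
        Cmult z d = Cmult (f z) (phi z)) /\
    subordinate phi (fun z => Cplus (RtoC 1) (g z)).

Definition toRi (z : C) : R[i] := Complex (fst z) (snd z).
Definition ofRi (z : R[i]) : C := (Re z, Im z).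

Section Hankel.
Local Open Scope ring_scope.
Definition H41 (a : nat -> C) : C :=
  ofRi (\det (\matrix_(i < 4, j < 4)
                 toRi (a (nat_of_ord i + nat_of_ord j + 1)%N))).
End Hankel.

(* Main.v *)
Require Import Defs.
From Stdlib Require Import Reals Ranalysis5 Lra Lia.
From Coquelicot Require Import Coquelicot.
From mathcomp Require all_boot all_algebra complex Rstruct ring.

(** Write [f = z F], where [F] is a power series with [F 0 = 1] and, by
    univalence, without zeros in the disk, and [u = phi - 1 = z F' / F].
    Since [sinh u = w] with [|w| < 1], a continuity argument keeps [u] in the
    component of [{|sinh| < 1}] around [0], where [|u| <= pi/2 < 8/5].

    The Taylor coefficients [p_k] of [u] thus satisfy [sum |p_k|^2 <= (8/5)^2].
    No Cauchy theory is used for this: dividing successively by [z], one gets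
    functions [K_n = N_n / F] with [N_n] a power series on the whole disk and
    [K_n = p_n + z K_(n+1)], and the mean of [|K_n|^2] on a circle of radius [r]
    is [|p_n|^2 + r^2] times the mean of [|K_(n+1)|^2], because the mean of
    the real part of a holomorphic function vanishing at [0] is [0].

    Finally [H41] is a polynomial with 53 monomials in [p_1, ..., p_6], and the
    sum of their absolute values is far below the claimed bound on that ball. *)

Local Open Scope R_scope.

(* [in_disk] is stated with the order of the MathComp structure on [R]. *)
Lemma in_diskE (z : C) : in_disk z <-> Cmod z < 1.
Proof.
split; [exact (ssrbool.elimT Rstruct.RltP)|exact (ssrbool.introT Rstruct.RltP)].
Qed.

(** * Continuity and complex derivatives *)

(** The target carries the product uniform structure of [C_UniformSpace]. Derivatives over
    [C_AbsRing] use the one given by the modulus; [locally_C] passes between the two. *)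
Local Notation Ccontinuous f x := (@continuous _ C_UniformSpace f x).

Lemma Ccontinuous_components {U : UniformSpace} (f : U -> C) (x : U) :
  Ccontinuous f x <->
  continuous (fun y => fst (f y)) x /\ continuous (fun y => snd (f y)) x.
Proof.
split.
- intros Hf; split.
  + apply (continuous_comp (V := C_UniformSpace) (W := R_UniformSpace) f fst); trivial.
    destruct (f x); apply continuous_fst.
  + apply (continuous_comp (V := C_UniformSpace) (W := R_UniformSpace) f snd); trivial.
    destruct (f x); apply continuous_snd.
- intros [H1 H2] P [e He]; change (locally x (fun y => P (f y))).
  generalize (proj1 (filterlim_locally _ _) H1 e) (proj1 (filterlim_locally _ _) H2 e).
  intros K1 K2; generalize (filter_and _ _ K1 K2).
  apply filter_imp; intros y [Hy1 Hy2]; apply He; split; assumption.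
Qed.

Lemma Ccontinuous_plus {U : UniformSpace} (f g : U -> C) (x : U) :
  Ccontinuous f x -> Ccontinuous g x -> Ccontinuous (fun y => f y + g y)%C x.
Proof.
intros Hf Hg; apply Ccontinuous_components in Hf, Hg; apply Ccontinuous_components.
destruct Hf, Hg; split; now apply (continuous_plus (V := R_NormedModule)).
Qed.

Lemma Ccontinuous_opp {U : UniformSpace} (f : U -> C) (x : U) :
  Ccontinuous f x -> Ccontinuous (fun y => - f y)%C x.
Proof.
intros Hf; apply Ccontinuous_components in Hf; apply Ccontinuous_components.
destruct Hf; split; now apply (continuous_opp (V := R_NormedModule)).
Qed.

Lemma Ccontinuous_mult {U : UniformSpace} (f g : U -> C) (x : U) :
  Ccontinuous f x -> Ccontinuous g x -> Ccontinuous (fun y => f y * g y)%C x.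
Proof.
intros Hf Hg; apply Ccontinuous_components in Hf, Hg; apply Ccontinuous_components.
destruct Hf, Hg; split.
- apply (continuous_minus (V := R_NormedModule)); now apply (continuous_mult (K := R_AbsRing)).
- apply (continuous_plus (V := R_NormedModule)); now apply (continuous_mult (K := R_AbsRing)).
Qed.

Lemma sqnorm_neq_0 (z : C) : z <> RtoC 0 -> fst z ^ 2 + snd z ^ 2 <> 0.
Proof.
intros Hz H; apply Hz; destruct z as [x y]; simpl in *.
assert (x = 0) by nra; assert (y = 0) by nra; now subst.
Qed.

Lemma continuous_sqr {U : UniformSpace} (f : U -> R) (x : U) :
  continuous f x -> continuous (fun y => f y ^ 2) x.
Proof.
intros Hf; apply (continuous_ext (fun y => f y * f y)); [intros y; simpl; ring|].
now apply (continuous_mult (K := R_AbsRing)).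
Qed.

Lemma Ccontinuous_inv {U : UniformSpace} (f : U -> C) (x : U) :
  f x <> RtoC 0 -> Ccontinuous f x -> Ccontinuous (fun y => / f y)%C x.
Proof.
intros H0 Hf; apply Ccontinuous_components in Hf; apply Ccontinuous_components.
destruct Hf as [H1 H2].
assert (Hd : continuous (fun y => / (fst (f y) ^ 2 + snd (f y) ^ 2)) x).
{ apply (continuous_comp (fun y => fst (f y) ^ 2 + snd (f y) ^ 2) Rinv).
  - now apply (continuous_plus (V := R_NormedModule)); apply continuous_sqr.
  - now apply continuous_Rinv, sqnorm_neq_0. }
split; simpl; apply (continuous_mult (K := R_AbsRing)); trivial.
now apply (continuous_opp (V := R_NormedModule)).
Qed.

Lemma Cmod_le_abs (z : C) : Cmod z <= Rabs (fst z) + Rabs (snd z).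
Proof.
assert (H1 := Rabs_pos (fst z)); assert (H2 := Rabs_pos (snd z)).
unfold Cmod; rewrite <- (sqrt_Rsqr (Rabs (fst z) + Rabs (snd z))) by lra.
apply sqrt_le_1_alt; unfold Rsqr.
rewrite <- (pow2_abs (fst z)), <- (pow2_abs (snd z)); nra.
Qed.

(** Product balls and modulus balls are comparable, because
    [max(|Re|, |Im|) <= Cmod <= |Re| + |Im|]. *)
Lemma Ccontinuous_eps (f : C -> C) (z : C) :
  Ccontinuous f z <->
  forall e, 0 < e -> exists d, 0 < d /\
    forall y, Cmod (y - z) < d -> Cmod (f y - f z) < e.
Proof.
split.
- intros Hf e He.
  assert (He2 : 0 < e / 2) by lra.
  destruct (proj1 (locally_C z _) (proj1 (filterlim_locally _ _) Hf (mkposreal _ He2)))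
    as [d Hd].
  exists d; split; [apply cond_pos|]; intros y Hy.
  destruct (Hd y Hy) as [H1 H2]; simpl in H1, H2.
  apply Rle_lt_trans with (1 := Cmod_le_abs _).
  change (Rabs (fst (f y) - fst (f z)) < e / 2) in H1.
  change (Rabs (snd (f y) - snd (f z)) < e / 2) in H2.
  change (Rabs (fst (f y) - fst (f z)) + Rabs (snd (f y) - snd (f z)) < e); lra.
- intros H; apply filterlim_locally; intros e.
  destruct (H e (cond_pos e)) as [d [Hd0 Hd]].
  apply locally_C; exists (mkposreal d Hd0); intros y Hy.
  specialize (Hd y Hy).
  assert (Hm := Rmax_Cmod (f y - f z)%C).
  split; apply Rle_lt_trans with (2 := Hd); eapply Rle_trans; try exact Hm.
  + apply Rmax_l.
  + apply Rmax_r.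
Qed.

(* Caratheodory's form of the derivative: the difference quotient extends to
   a function continuous at [z] with value [l]. *)
Definition cderiv (f : C -> C) (z l : C) : Prop :=
  exists q : C -> C, Ccontinuous q z /\ q z = l /\
    locally (T := C_UniformSpace) z (fun y => f y = (f z + q y * (y - z))%C :> C).

Lemma cderiv_continuous (f : C -> C) (z l : C) : cderiv f z l -> Ccontinuous f z.
Proof.
intros [q [Hq [_ Hf]]].
apply (continuous_ext_loc (T := C_UniformSpace) (U := C_UniformSpace) _
         (fun y => f z + q y * (y - z))%C); [revert Hf; apply filter_imp; intros y Hy; symmetry; exact Hy|].
apply Ccontinuous_plus; [apply continuous_const|].
apply Ccontinuous_mult; trivial.
apply Ccontinuous_plus; [apply continuous_id|apply continuous_const].
Qed.

Lemma cderiv_of_eps (f : C -> C) (z l : C) :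
  (forall e, 0 < e -> exists d, 0 < d /\ forall y, Cmod (y - z) < d ->
     Cmod (f y - f z - l * (y - z)) <= e * Cmod (y - z)) ->
  cderiv f z l.
Proof.
intros H.
(* The difference quotient, completed by the value [l] at [z]; the hypothesis is exactly its
   continuity there. *)
exists (fun y => if Ceq_dec y z then l else (f y - f z) / (y - z))%C.
assert (E : forall c : C, (if Ceq_dec z z then l else c) = l)
  by (intros c; destruct (Ceq_dec z z) as [e|n]; [trivial|now destruct n]).
split; [|split].
- apply Ccontinuous_eps; intros e He.
  destruct (H (e / 2)) as [d [Hd0 Hd]]; [lra|].
  exists d; split; trivial; intros y Hy; rewrite E.
  destruct (Ceq_dec y z) as [_|n].
  + replace (l - l)%C with (RtoC 0) by ring; now rewrite Cmod_0.
  + assert (n' : (y - z)%C <> RtoC 0).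
    { intros K; apply n; replace y with (y - z + z)%C by ring; rewrite K; ring. }
    specialize (Hd y Hy).
    replace ((f y - f z) / (y - z) - l)%C with ((f y - f z - l * (y - z)) / (y - z))%C
      by (field; trivial).
    rewrite Cmod_div by trivial.
    apply Cmod_gt_0 in n'.
    apply Rle_lt_trans with (e / 2); [|lra].
    now apply Rle_div_l.
- now rewrite E.
- apply filter_forall; intros y; destruct (Ceq_dec y z) as [->|n]; [ring|].
  field; intros K; apply n; replace y with (y - z + z)%C by ring; rewrite K; ring.
Qed.

(** Needed because [in_S_rho] states its differential equation with [is_derive]. *)
Lemma cderiv_is_derive (f : C -> C) (z l : C) :
  cderiv f z l -> @is_derive C_AbsRing C_NormedModule f z l.
Proof.
intros [q [Hq [Hl Hf]]]; split; [apply is_linear_scal_l|].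
intros x Hx; apply (is_filter_lim_locally_unique (V := AbsRing_NormedModule C_AbsRing)) in Hx.
subst x; intros e.
destruct (proj1 (Ccontinuous_eps _ _) Hq e (cond_pos e)) as [d [Hd0 Hd]].
assert (Hloc : locally (T := AbsRing_UniformSpace C_AbsRing) z
                (fun y => Cmod (q y - q z) < e)).
{ exists (mkposreal d Hd0); exact Hd. }
generalize (filter_and _ _ Hloc (proj1 (locally_C _ _) Hf)).
apply filter_imp; clear d Hd0 Hd Hloc; intros y [Hd Hy].
change (Cmod (f y - f z - (y - z) * l) <= e * Cmod (y - z)).
rewrite Hy, <- Hl.
replace (f z + q y * (y - z) - f z - (y - z) * q z)%C with ((q y - q z) * (y - z))%C by ring.
rewrite Cmod_mult; apply Rmult_le_compat_r; [apply Cmod_ge_0|lra].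
Qed.

Lemma ex_derive_Ccontinuous (f : C -> C) (z : C) :
  @ex_derive C_AbsRing C_NormedModule f z -> Ccontinuous f z.
Proof.
intros H P HP; apply locally_C.
exact (ex_derive_continuous (K := C_AbsRing) (V := C_NormedModule) f z H P HP).
Qed.

Lemma cderiv_const (c z : C) : cderiv (fun _ => c) z (RtoC 0).
Proof.
exists (fun _ => RtoC 0); split; [apply continuous_const|]; split; trivial; apply filter_forall; intros y; simpl in y; ring.
Qed.

Lemma cderiv_id (z : C) : cderiv (fun y => y) z (RtoC 1).
Proof.
exists (fun _ => RtoC 1); split; [apply continuous_const|]; split; trivial; apply filter_forall; intros y; simpl in y; ring.
Qed.

Lemma cderiv_mult (f g : C -> C) (z lf lg : C) :
  cderiv f z lf -> cderiv g z lg ->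
  cderiv (fun y => f y * g y)%C z (lf * g z + f z * lg)%C.
Proof.
intros Hcf Hcg; assert (Cg := cderiv_continuous _ _ _ Hcg).
destruct Hcf as [p [Hp [<- Hf]]], Hcg as [q [Hq [<- Hg]]].
(* From [f y g y - f z g z = (f y - f z) g y + f z (g y - g z)]. *)
exists (fun y => p y * g y + f z * q y)%C; split; [|split; trivial].
- apply Ccontinuous_plus; apply Ccontinuous_mult; trivial; apply continuous_const.
- generalize (filter_and _ _ Hf Hg); apply filter_imp; intros y [-> ->]; ring.
Qed.

Lemma Ccontinuous_neq_0 (f : C -> C) (z : C) :
  Ccontinuous f z -> f z <> RtoC 0 ->
  locally (T := C_UniformSpace) z (fun y => f y <> RtoC 0).
Proof.
intros Hf H0; apply Cmod_gt_0 in H0.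
destruct (proj1 (Ccontinuous_eps _ _) Hf _ H0) as [d [Hd0 Hd]].
apply locally_C; exists (mkposreal d Hd0); intros y Hy K; specialize (Hd y Hy).
rewrite K in Hd; replace (0 - f z)%C with (- f z)%C in Hd by ring.
rewrite Cmod_opp in Hd; lra.
Qed.

Lemma cderiv_inv (f : C -> C) (z l : C) :
  f z <> RtoC 0 -> cderiv f z l ->
  cderiv (fun y => / f y)%C z (- l * (/ f z * / f z))%C.
Proof.
intros H0 Hcf; assert (Cf := cderiv_continuous _ _ _ Hcf).
destruct Hcf as [q [Hq [<- Hf]]].
exists (fun y => - q y * (/ f y * / f z))%C; split; [|split; trivial].
- apply Ccontinuous_mult; [now apply Ccontinuous_opp|].
  apply Ccontinuous_mult; [now apply Ccontinuous_inv|apply continuous_const].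
- generalize (filter_and _ _ Hf (Ccontinuous_neq_0 _ _ Cf H0)); apply filter_imp.
  intros y [Hy Hy0].
  replace (- q y * (/ f y * / f z) * (y - z))%C
    with (- (f z + q y * (y - z) - f z) * (/ f y * / f z))%C by ring.
  rewrite <- Hy; field; now split.
Qed.

Lemma cderiv_ext_loc (f g : C -> C) (z l : C) :
  locally (T := C_UniformSpace) z (fun y => f y = g y) -> cderiv f z l -> cderiv g z l.
Proof.
intros E [q [Hq [Hl Hf]]]; exists q; split; [|split]; trivial.
generalize (filter_and _ _ E Hf) (locally_singleton _ _ E); intros H Ez; revert H.
apply filter_imp; intros y [Ey Hy]; now rewrite <- Ey, <- Ez.
Qed.

(** The product rule does not apply, [A] being merely continuous; the vanishing of [g x - g s] at
    [s] makes up for it. *)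
Lemma is_derive_mult_increment (A g : R -> R) (s d : R) :
  continuous A s -> is_derive g s d ->
  is_derive (fun x => A x * (g x - g s)) s (A s * d).
Proof.
intros HA Hg.
apply is_derive_Reals in Hg; apply is_derive_Reals; intros e He.
assert (Hd := Rabs_pos d); assert (HAs := Rabs_pos (A s)).
assert (He1 : 0 < e / (2 * (Rabs d + 1))) by (apply Rdiv_lt_0_compat; lra).
assert (He2 : 0 < e / (2 * (Rabs (A s) + 1))) by (apply Rdiv_lt_0_compat; lra).
(* The bound 1 keeps [|A (s + h)|] below [|A s| + 1]; each of the two terms of the error then
   contributes at most [e / 2]. *)
assert (He0 : 0 < Rmin 1 (e / (2 * (Rabs d + 1)))) by (apply Rmin_pos; lra).
destruct (proj1 (filterlim_locally _ _) HA (mkposreal _ He0)) as [d1 H1].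
destruct (Hg _ He2) as [d2 H2].
assert (Hd0 : 0 < Rmin d1 d2) by (apply Rmin_pos; apply cond_pos).
exists (mkposreal _ Hd0); simpl; intros h Hh0 Hh.
assert (K1 : Rabs (A (s + h) - A s) < Rmin 1 (e / (2 * (Rabs d + 1)))).
{ apply (H1 (s + h)); change (Rabs (s + h - s) < d1).
  replace (s + h - s) with h by ring; eapply Rlt_le_trans; [exact Hh|apply Rmin_l]. }
assert (K2 : Rabs ((g (s + h) - g s) / h - d) < e / (2 * (Rabs (A s) + 1))).
{ apply H2; trivial; eapply Rlt_le_trans; [exact Hh|apply Rmin_r]. }
replace ((A (s + h) * (g (s + h) - g s) - A s * (g s - g s)) / h - A s * d)
  with (A (s + h) * ((g (s + h) - g s) / h - d) + (A (s + h) - A s) * d) by (field; trivial).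
apply Rle_lt_trans with (1 := Rabs_triang _ _); rewrite 2!Rabs_mult.
assert (K3 := Rlt_le_trans _ _ _ K1 (Rmin_l _ _)).
assert (K4 := Rlt_le_trans _ _ _ K1 (Rmin_r _ _)).
assert (K5 : Rabs (A (s + h)) <= Rabs (A s) + 1).
{ replace (A (s + h)) with (A s + (A (s + h) - A s)) by ring.
  eapply Rle_trans; [apply Rabs_triang|lra]. }
apply Rlt_div_r in K2; [|lra]; apply Rlt_div_r in K4; [|lra].
assert (K6 := Rabs_pos ((g (s + h) - g s) / h - d)).
assert (K7 := Rabs_pos (A (s + h) - A s)).
nra.
Qed.


(** By Caratheodory's form, each component of [h] along the curve is a constant plus products of a
    continuous factor and an increment. Components are separated because the integrals to come are
    real. *)
Lemma cderiv_curve (h : C -> C) (gx gy : R -> R) (s dx dy : R) (l : C) :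
  cderiv h (gx s, gy s) l -> is_derive gx s dx -> is_derive gy s dy ->
  is_derive (fun t => fst (h (gx t, gy t))) s (fst (l * (dx, dy))%C) /\
  is_derive (fun t => snd (h (gx t, gy t))) s (snd (l * (dx, dy))%C).
Proof.
intros [q [Hq [<- Hh]]] Hx Hy.
assert (Hc : Ccontinuous (fun t => (gx t, gy t)) s).
{ apply Ccontinuous_components; split; simpl;
    apply (ex_derive_continuous (V := R_NormedModule)); eexists; eassumption. }
assert (Hqc := continuous_comp (V := C_UniformSpace) (W := C_UniformSpace) _ q s Hc Hq).
apply Ccontinuous_components in Hqc; destruct Hqc as [Hq1 Hq2].
assert (Hl : locally s (fun t => h (gx t, gy t) =
   h (gx s, gy s) + q (gx t, gy t) * ((gx t, gy t) - (gx s, gy s)))%C) by exact (Hc _ Hh).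
split.
- apply (is_derive_ext_loc (fun t => fst (h (gx s, gy s)) +
     (fst (q (gx t, gy t)) * (gx t - gx s) - snd (q (gx t, gy t)) * (gy t - gy s)))).
  + revert Hl; apply filter_imp; intros t ->; simpl; ring.
  + evar_last.
    * apply @is_derive_plus; [apply is_derive_const|].
      apply @is_derive_minus; apply is_derive_mult_increment; eassumption.
    * simpl; unfold minus, plus, opp, zero; simpl; ring.
- apply (is_derive_ext_loc (fun t => snd (h (gx s, gy s)) +
     (fst (q (gx t, gy t)) * (gy t - gy s) + snd (q (gx t, gy t)) * (gx t - gx s)))).
  + revert Hl; apply filter_imp; intros t ->; simpl; ring.
  + evar_last.
    * apply @is_derive_plus; [apply is_derive_const|].
      apply @is_derive_plus; apply is_derive_mult_increment; eassumption.
    * simpl; unfold minus, plus, opp, zero; simpl; ring.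
Qed.

(** * Power series on the unit disk *)

Definition power_sum (a : nat -> C) (f : C -> C) : Prop :=
  forall z, in_disk z -> @is_pseries C_AbsRing C_NormedModule a z (f z).

Lemma is_pseries_C (a : nat -> C) (z l : C) :
  @is_pseries C_AbsRing C_NormedModule a z l <->
  @is_series C_AbsRing C_NormedModule (fun n => a n * z ^ n)%C l.
Proof.
assert (E : forall n, @scal C_AbsRing C_NormedModule (@pow_n C_AbsRing z n) (a n)
                      = (a n * z ^ n)%C).
{ intros n; change (@pow_n C_AbsRing z n * a n = a n * z ^ n)%C.
  assert (Ep : @pow_n C_AbsRing z n = (z ^ n)%C).
  { induction n as [|n IH]; [reflexivity|]; simpl; now rewrite IH. }
  rewrite Ep; ring. }
split; intros H.
- now apply is_series_ext with (2 := H).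
- now apply is_series_ext with (2 := H); intros n; rewrite E.
Qed.

Lemma Cmod_series_le (u : nat -> C) (v : nat -> R) (l : C) (L : R) :
  (forall n, Cmod (u n) <= v n) ->
  @is_series C_AbsRing C_NormedModule u l -> is_series v L -> Cmod l <= L.
Proof.
intros Huv Hu Hv.
assert (Hn : is_lim_seq (fun n => Cmod (@sum_n C_NormedModule u n)) (Cmod l)).
{ exact (filterlim_comp _ _ _ _ _ _ _ _ Hu
    (filterlim_norm (V := C_NormedModule) (l : C_NormedModule))). }
assert (Hv' : is_lim_seq (sum_n v) L) by exact Hv.
refine (is_lim_seq_le _ _ (Cmod l) L _ Hn Hv'); intros n.
eapply Rle_trans; [apply (norm_sum_n_m (V := C_NormedModule))|].
now apply sum_n_m_le.
Qed.

(** Beyond index 0, a term is the difference of two consecutive partial sums, and these converge,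
    hence are bounded. *)
Lemma series_terms_bounded (u : nat -> C) (l : C) :
  @is_series C_AbsRing C_NormedModule u l -> exists M, forall n, Cmod (u n) <= M.
Proof.
intros Hu.
assert (Hn : is_lim_seq (fun n => Cmod (@sum_n C_NormedModule u n)) (Cmod l)).
{ exact (filterlim_comp _ _ _ _ _ _ _ _ Hu
    (filterlim_norm (V := C_NormedModule) (l : C_NormedModule))). }
apply is_lim_seq_Reals in Hn.
destruct (maj_by_pos _ (exist _ _ Hn)) as [M [HM0 HM]].
assert (HM' : forall n, Cmod (@sum_n C_NormedModule u n) <= M).
{ intros n; eapply Rle_trans; [apply Rle_abs|apply HM]. }
exists (M + M); intros [|n].
- specialize (HM' O); rewrite sum_O in HM'; lra.
- assert (K1 := HM' (S n)); assert (K2 := HM' n); rewrite sum_Sn in K1.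
  replace (u (S n)) with
    (@plus C_NormedModule (@sum_n C_NormedModule u n) (u (S n))
      - @sum_n C_NormedModule u n)%C.
  + unfold Cminus; eapply Rle_trans; [apply Cmod_triangle|]; rewrite Cmod_opp; lra.
  + change (@sum_n C_NormedModule u n + u (S n) - @sum_n C_NormedModule u n = u (S n))%C.
    ring.
Qed.

(** Convergence at the real point [s = (1 + r) / 2] bounds the terms [|a_n| s^n], so the radius is
    at least [s > r]. This opens the way to the real theory of [PSeries]. *)
Lemma power_sum_radius (a : nat -> C) (f : C -> C) (r : R) :
  power_sum a f -> 0 <= r < 1 -> Rbar_lt r (CV_radius (fun n => Cmod (a n))).
Proof.
intros Hf Hr; set (s := (1 + r) / 2).
assert (Hs : in_disk (RtoC s)).
{ apply in_diskE; rewrite Cmod_R, Rabs_pos_eq; unfold s; lra. }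
destruct (series_terms_bounded _ _ (proj1 (is_pseries_C _ _ _) (Hf _ Hs))) as [M HM].
apply Rbar_lt_le_trans with s; [unfold s; simpl; lra|].
apply (proj1 (CV_radius_bounded _)); exists M; intros n.
replace (Rabs (Cmod (a n) * s ^ n)) with (Cmod (a n * RtoC s ^ n)%C); [apply HM|].
rewrite Cmod_mult, Cmod_pow, Cmod_R, Rabs_mult, RPow_abs.
now rewrite (Rabs_pos_eq (Cmod _)) by apply Cmod_ge_0.
Qed.

Definition Cps_derive (a : nat -> C) (n : nat) : C := (RtoC (INR (S n)) * a (S n))%C.

(** The remainder satisfies [R_(n+1) = (z + h) R_n + n z^(n-1) h^2], and the right-hand side obeys
    the same recursion in the moduli, so the triangle inequality carries the bound along. *)
Lemma Cpow_remainder_le (z h : C) (n : nat) :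
  Cmod ((z + h) ^ n - z ^ n - RtoC (INR n) * z ^ (n - 1) * h)%C <=
  (Cmod z + Cmod h) ^ n - Cmod z ^ n - INR n * Cmod z ^ (n - 1) * Cmod h.
Proof.
induction n as [|n IH].
- simpl; replace (1 - 1 - 0 * 1 * h)%C with (RtoC 0) by ring; rewrite Cmod_0; lra.
- replace (S n - 1)%nat with n by lia; rewrite S_INR, RtoC_plus.
  (* At [n = 0] the exponent [n - 1] is truncated, but the factor [INR n] vanishes. *)
  assert (Ez : (RtoC (INR n) * z ^ n = RtoC (INR n) * z ^ (n - 1) * z)%C).
  { destruct n; [simpl; ring|]. replace (S n - 1)%nat with n by lia; simpl Cpow; ring. }
  assert (Ex : INR n * Cmod z ^ n = INR n * Cmod z ^ (n - 1) * Cmod z).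
  { destruct n; [simpl; ring|]. replace (S n - 1)%nat with n by lia; simpl pow; ring. }
  replace ((z + h) ^ S n - z ^ S n - (RtoC (INR n) + RtoC 1) * z ^ n * h)%C
    with ((z + h) * ((z + h) ^ n - z ^ n - RtoC (INR n) * z ^ (n - 1) * h)
          + RtoC (INR n) * z ^ (n - 1) * h * h)%C
    by (replace ((RtoC (INR n) + RtoC 1) * z ^ n * h)%C
          with (RtoC (INR n) * z ^ n * h + z ^ n * h)%C by ring;
        rewrite Ez; simpl Cpow; ring).
  replace ((Cmod z + Cmod h) ^ S n - Cmod z ^ S n - (INR n + 1) * Cmod z ^ n * Cmod h)
    with ((Cmod z + Cmod h) *
           ((Cmod z + Cmod h) ^ n - Cmod z ^ n - INR n * Cmod z ^ (n - 1) * Cmod h)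
          + INR n * Cmod z ^ (n - 1) * Cmod h * Cmod h)
    by (replace ((INR n + 1) * Cmod z ^ n * Cmod h)
          with (INR n * Cmod z ^ n * Cmod h + Cmod z ^ n * Cmod h) by ring;
        rewrite Ex; simpl pow; ring).
  eapply Rle_trans; [apply Cmod_triangle|]; rewrite !Cmod_mult, Cmod_pow, Cmod_R.
  rewrite (Rabs_pos_eq (INR n)) by apply pos_INR.
  apply Rplus_le_compat_r, Rmult_le_compat; try apply Cmod_ge_0; trivial.
  apply Cmod_triangle.
Qed.

(** Reindexes the derived series to start at a zeroth term, null because of [INR 0], so that it can
    be subtracted termwise in the remainder. *)
Lemma is_series_derived_C (a : nat -> C) (z h l : C) :
  @is_pseries C_AbsRing C_NormedModule (Cps_derive a) z l ->
  @is_series C_AbsRing C_NormedModule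
    (fun n => a n * (RtoC (INR n) * z ^ (n - 1) * h))%C (l * h)%C.
Proof.
intros H; apply is_pseries_C in H.
apply is_series_decr_1.
apply (is_series_ext (V := C_NormedModule)
  (fun n => @scal C_AbsRing C_NormedModule h (Cps_derive a n * z ^ n)%C)).
- intros n; replace (S n - 1)%nat with n by lia; unfold Cps_derive.
  change (h * (RtoC (INR (S n)) * a (S n) * z ^ n) =
          a (S n) * (RtoC (INR (S n)) * z ^ n * h))%C; ring.
- evar_last.
  + apply (is_series_scal (V := C_NormedModule)), H.
  + change (h * l = l * h - (a 0%nat * (RtoC 0 * z ^ (0 - 1) * h)))%C; ring.
Qed.

Lemma is_series_derived_R (a : nat -> R) (x y l : R) :
  is_pseries (PS_derive a) x l ->
  is_series (fun n => a n * (INR n * x ^ (n - 1) * y)) (l * y).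
Proof.
intros H; apply is_pseries_R in H.
apply is_series_decr_1.
apply (is_series_ext (V := R_NormedModule) (fun n => scal y (PS_derive a n * x ^ n))).
- intros n; replace (S n - 1)%nat with n by lia; unfold PS_derive.
  change (y * (INR (S n) * a (S n) * x ^ n) =
          a (S n) * (INR (S n) * x ^ n * y)); ring.
- evar_last.
  + apply (is_series_scal (V := R_NormedModule)), H.
  + change (y * l = l * y - (a 0%nat * (0 * x ^ (0 - 1) * y))); ring.
Qed.

(* The remainder of the first-order expansion is dominated termwise by the one
   of the real series with coefficients [Cmod (a n)], which is [o(Cmod h)]. *)
Lemma power_sum_cderiv_at (a : nat -> C) (f : C -> C) (z : C) :
  power_sum a f -> in_disk z -> exists l,
    @is_pseries C_AbsRing C_NormedModule (Cps_derive a) z l /\ cderiv f z l.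
Proof.
intros Hf Hz; set (A := fun n => Cmod (a n)); apply in_diskE in Hz.
assert (Hz0 := Cmod_ge_0 z).
assert (Hr := fun r => power_sum_radius a f r Hf); fold A in Hr.
assert (Hex : exists l, @is_pseries C_AbsRing C_NormedModule (Cps_derive a) z l).
(* The derived series converges absolutely: the real series with coefficients [|a_n|] keeps its
   radius under differentiation. *)
{ specialize (Hr _ (conj Hz0 Hz)); rewrite <- CV_radius_derive in Hr.
  rewrite <- (Rabs_pos_eq (Cmod z)) in Hr by trivial.
  apply CV_disk_inside in Hr.
  destruct (ex_series_le (V := C_CompleteNormedModule)
    (fun n => Cps_derive a n * z ^ n)%C _ (fun n => Req_le _ _ eq_refl)) as [l Hl].
  - apply (ex_series_ext (V := R_NormedModule)) with (2 := Hr); intros n.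
    change (Rabs (PS_derive A n * Cmod z ^ n) = Cmod (Cps_derive a n * z ^ n)%C).
    unfold Cps_derive, PS_derive, A; rewrite !Rabs_mult, !Cmod_mult, Cmod_pow, Cmod_R.
    rewrite <- RPow_abs, !(Rabs_pos_eq (Cmod _)); trivial; apply Cmod_ge_0.
  - exists l; now apply is_pseries_C. }
destruct Hex as [l Hl]; exists l; split; trivial.
assert (HA : Rbar_lt (Rabs (Cmod z)) (CV_radius A)) by (rewrite Rabs_pos_eq; auto).
assert (HdA := is_derive_PSeries A (Cmod z) HA).
apply is_derive_Reals in HdA.
apply cderiv_of_eps; intros e He.
destruct (HdA e He) as [d Hd].
(* The second bound gives [|z| + |h| < 1]: [y] stays in the disk and the real series converges at
   [|z| + |h|]. *)
exists (Rmin d (1 - Cmod z)); split; [apply Rmin_pos; [apply cond_pos|lra]|].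
intros y Hy; set (h := (y - z)%C) in *.
assert (Ey : y = (z + h)%C) by (unfold h; ring).
assert (Hh0 := Cmod_ge_0 h).
assert (Hh1 := Rlt_le_trans _ _ _ Hy (Rmin_l _ _)).
assert (Hh2 := Rlt_le_trans _ _ _ Hy (Rmin_r _ _)).
assert (HyD : in_disk y).
{ apply in_diskE; rewrite Ey; eapply Rle_lt_trans; [apply Cmod_triangle|lra]. }
set (x := Cmod z) in *; set (t := Cmod h) in *.
apply Rle_trans with (PSeries A (x + t) - PSeries A x - PSeries (PS_derive A) x * t).
- apply (Cmod_series_le
    (fun n => a n * ((z + h) ^ n - z ^ n - RtoC (INR n) * z ^ (n - 1) * h))%C
    (fun n => A n * ((x + t) ^ n - x ^ n - INR n * x ^ (n - 1) * t))).
  + intros n; rewrite Cmod_mult; apply Rmult_le_compat_l; [apply Cmod_ge_0|].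
    apply Cpow_remainder_le.
  + apply in_diskE in Hz; apply (is_series_ext (V := C_NormedModule) (fun n => a n * y ^ n - a n * z ^ n
       - a n * (RtoC (INR n) * z ^ (n - 1) * h))%C).
    { intros n; rewrite Ey; simpl; ring. }
    apply (is_series_minus (V := C_NormedModule)); [apply (is_series_minus (V := C_NormedModule))|].
    * apply is_pseries_C; now apply Hf.
    * apply is_pseries_C; now apply Hf.
    * now apply is_series_derived_C.
  + apply (is_series_ext (V := R_NormedModule)
      (fun n => A n * (x + t) ^ n - A n * x ^ n - A n * (INR n * x ^ (n - 1) * t))).
    { intros n; simpl; ring. }
    apply (is_series_minus (V := R_NormedModule)); [apply (is_series_minus (V := R_NormedModule))|].
    * apply is_pseries_R, PSeries_correct, CV_radius_inside; rewrite Rabs_pos_eq; [apply Hr|]; lra.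
    * apply is_pseries_R, PSeries_correct, CV_radius_inside; trivial.
    * apply is_series_derived_R, PSeries_correct, CV_radius_inside.
      now rewrite CV_radius_derive.
- destruct (Req_dec t 0) as [Et|Et].
  + rewrite Et, Rplus_0_r; lra.
  + specialize (Hd t Et); rewrite (Rabs_pos_eq t) in Hd by trivial.
    specialize (Hd Hh1); apply Rabs_def2 in Hd; destruct Hd as [Hd _].
    assert (Ht : 0 < t) by lra.
    replace (PSeries A (x + t) - PSeries A x - PSeries (PS_derive A) x * t)
      with (((PSeries A (x + t) - PSeries A x) / t - PSeries (PS_derive A) x) * t)
      by (field; trivial).
    apply Rmult_le_compat_r; lra.
Qed.

(** The derivative being again a power series on the disk, the statement can be iterated;
    [power_sum_C1] applies it twice. *)
Lemma power_sum_cderiv (a : nat -> C) (f : C -> C) :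
  power_sum a f -> power_sum (Cps_derive a) (C_derive f) /\
    forall z, in_disk z -> cderiv f z (C_derive f z).
Proof.
intros Hf; split; intros z Hz;
  destruct (power_sum_cderiv_at a f z Hf Hz) as [l [Hl Hd]];
  rewrite (is_C_derive_unique f z l); trivial; now apply cderiv_is_derive.
Qed.

(** Continuity of the derivative is included for the sake of differentiation under the integral sign
    and of the fundamental theorem of calculus on circles. *)
Definition C1_holomorphic (h : C -> C) : Prop :=
  exists h', forall z, in_disk z -> cderiv h z (h' z) /\ Ccontinuous h' z.

Lemma C1_holomorphic_continuous (h : C -> C) (z : C) :
  C1_holomorphic h -> in_disk z -> Ccontinuous h z.
Proof. intros [h' H] Hz; exact (cderiv_continuous _ _ _ (proj1 (H z Hz))). Qed.

Lemma power_sum_C1 (a : nat -> C) (f : C -> C) : power_sum a f -> C1_holomorphic f.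
Proof.
intros Hf; destruct (power_sum_cderiv a f Hf) as [Hf1 Hd]; exists (C_derive f).
intros z Hz; split; [now apply Hd|].
destruct (power_sum_cderiv _ _ Hf1) as [_ Hd1].
exact (cderiv_continuous _ _ _ (Hd1 z Hz)).
Qed.

Lemma C1_holomorphic_const (c : C) : C1_holomorphic (fun _ => c).
Proof.
exists (fun _ => RtoC 0); intros z _; split; [apply cderiv_const|apply continuous_const].
Qed.

Lemma C1_holomorphic_id : C1_holomorphic (fun z => z).
Proof.
exists (fun _ => RtoC 1); intros z _; split; [apply cderiv_id|apply continuous_const].
Qed.

Lemma C1_holomorphic_mult (f g : C -> C) :
  C1_holomorphic f -> C1_holomorphic g -> C1_holomorphic (fun z => f z * g z)%C.
Proof.
intros Hf Hg.
assert (Cf := fun z => C1_holomorphic_continuous f z Hf).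
assert (Cg := fun z => C1_holomorphic_continuous g z Hg).
destruct Hf as [f' Hf], Hg as [g' Hg].
exists (fun z => f' z * g z + f z * g' z)%C; intros z Hz.
destruct (Hf z Hz), (Hg z Hz); split; [now apply cderiv_mult|].
apply Ccontinuous_plus; apply Ccontinuous_mult; auto.
Qed.

Lemma C1_holomorphic_inv (f : C -> C) :
  C1_holomorphic f -> (forall z, in_disk z -> f z <> RtoC 0) ->
  C1_holomorphic (fun z => / f z)%C.
Proof.
intros Hf H0; assert (Cf := fun z => C1_holomorphic_continuous f z Hf).
destruct Hf as [f' Hf]; exists (fun z => - f' z * (/ f z * / f z))%C.
intros z Hz; destruct (Hf z Hz); split; [apply cderiv_inv; auto|].
apply Ccontinuous_mult; [now apply Ccontinuous_opp|].
apply Ccontinuous_mult; apply Ccontinuous_inv; auto.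
Qed.

(** * Circle means *)

Definition circle (r t : R) : C := (r * cos t, r * sin t).

Lemma Cmod_sqr (z : C) : Cmod z ^ 2 = fst z ^ 2 + snd z ^ 2.
Proof. unfold Cmod; rewrite pow2_sqrt; trivial; nra. Qed.

Lemma sin2_cos2_pow (t : R) : sin t ^ 2 + cos t ^ 2 = 1.
Proof. generalize (sin2_cos2 t); unfold Rsqr; intros; nra. Qed.

Lemma Cmod_circle (r t : R) : Cmod (circle r t) ^ 2 = r ^ 2.
Proof.
rewrite Cmod_sqr; simpl fst; simpl snd.
replace (r ^ 2) with (r ^ 2 * (sin t ^ 2 + cos t ^ 2)) by (rewrite sin2_cos2_pow; ring).
ring.
Qed.

Lemma circle_in_disk (r t : R) : -1 < r < 1 -> in_disk (circle r t).
Proof.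
intros Hr; apply in_diskE.
assert (H := Cmod_circle r t); assert (H0 := Cmod_ge_0 (circle r t)); nra.
Qed.

Lemma continuous_circle (r t : R) :
  Ccontinuous (fun p : R * R => circle (fst p) (snd p)) (r, t).
Proof.
apply Ccontinuous_components; split; unfold circle; simpl;
  apply (continuous_mult (K := R_AbsRing)); try apply continuous_fst.
- apply (continuous_comp snd cos); [apply continuous_snd|apply continuous_cos].
- apply (continuous_comp snd sin); [apply continuous_snd|apply continuous_sin].
Qed.

Lemma continuous_circle_r (r t : R) : Ccontinuous (circle r) t.
Proof.
apply (continuous_comp_2 (fun _ => r) (fun t => t) circle);
  [apply continuous_const|apply continuous_id|apply continuous_circle].
Qed.

Lemma continuous_on_circle (h : C -> C) (r t : R) :
  (forall z, in_disk z -> Ccontinuous h z) -> -1 < r < 1 ->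
  Ccontinuous (fun t => h (circle r t)) t.
Proof.
intros Hh Hr.
apply (continuous_comp (V := C_UniformSpace) (W := C_UniformSpace) (circle r) h).
- apply continuous_circle_r.
- now apply Hh, circle_in_disk.
Qed.

Lemma ex_RInt_circle (h : C -> C) (r a b : R) :
  (forall z, in_disk z -> Ccontinuous h z) -> -1 < r < 1 ->
  ex_RInt (fun t => fst (h (circle r t))) a b /\
  ex_RInt (fun t => Cmod (h (circle r t)) ^ 2) a b.
Proof.
intros Hh Hr.
assert (K := fun t => proj1 (Ccontinuous_components _ _) (continuous_on_circle h r t Hh Hr)).
split; apply (ex_RInt_continuous (V := R_CompleteNormedModule)); intros t _;
  destruct (K t) as [K1 K2]; trivial.
apply (continuous_ext (fun t => fst (h (circle r t)) ^ 2 + snd (h (circle r t)) ^ 2)).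
- intros s; symmetry; apply Cmod_sqr.
- now apply (continuous_plus (V := R_NormedModule)); apply continuous_sqr.
Qed.

Lemma is_derive_circle_radius (h : C -> C) (r t : R) (l : C) :
  cderiv h (circle r t) l ->
  is_derive (fun s => fst (h (circle s t))) r (fst (l * (cos t, sin t))%C).
Proof.
intros H.
apply (cderiv_curve h (fun s => s * cos t) (fun s => s * sin t)); trivial;
  auto_derive; trivial; ring.
Qed.

(** The circle has velocity [i r e^(i t)], and [Im (i w) = Re w]. *)
Lemma is_derive_circle_angle (h : C -> C) (r t : R) (l : C) :
  cderiv h (circle r t) l ->
  is_derive (fun s => snd (h (circle r s))) t (r * fst (l * (cos t, sin t))%C).
Proof.
intros H; evar_last.
- apply (cderiv_curve h (fun s => r * cos s) (fun s => r * sin s)); [exact H| |];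
    auto_derive; trivial.
- simpl; ring.
Qed.

(* By the Cauchy-Riemann equations [r] times the radial derivative of [Re h] is
   the angular derivative of [Im h], so the mean of [Re h] does not depend on [r]. *)
Lemma circle_mean_0 (h : C -> C) (r : R) :
  C1_holomorphic h -> h (RtoC 0) = RtoC 0 -> 0 < r < 1 ->
  RInt (fun t => fst (h (circle r t))) 0 (2 * PI) = 0.
Proof.
intros Hh h0 Hr.
assert (Ch := fun z => C1_holomorphic_continuous h z Hh).
destruct Hh as [h' Hh].
set (D := fun s t => fst (h' (circle s t) * (cos t, sin t))%C).
assert (HD : forall s t, -1 < s < 1 -> is_derive (fun s => fst (h (circle s t))) s (D s t)).
{ intros s t Hs; apply is_derive_circle_radius, Hh, circle_in_disk, Hs. }
assert (CD : forall s t, -1 < s < 1 ->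
   continuous (fun p : R * R => D (fst p) (snd p)) (s, t)).
{ intros s t Hs.
  apply (fun H => proj1 (proj1 (Ccontinuous_components
    (fun p : R * R => h' (circle (fst p) (snd p)) * (cos (snd p), sin (snd p)))%C (s, t)) H)).
  apply Ccontinuous_mult.
  - apply (continuous_comp (V := C_UniformSpace) (W := C_UniformSpace)
             (fun p : R * R => circle (fst p) (snd p)) h'); [apply continuous_circle|].
    now apply Hh, circle_in_disk.
  - apply Ccontinuous_components; split; simpl.
    + apply (continuous_comp snd cos); [apply continuous_snd|apply continuous_cos].
    + apply (continuous_comp snd sin); [apply continuous_snd|apply continuous_sin]. }
assert (Hloc : forall s, -1 < s < 1 -> locally s (fun s => -1 < s < 1)).
{ intros s Hs; apply filter_and; [now apply open_gt|now apply open_lt]. }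
assert (HJ : forall s, -1 < s < 1 ->
  is_derive (fun s => RInt (fun t => fst (h (circle s t))) 0 (2 * PI)) s
            (RInt (D s) 0 (2 * PI))).
{ intros s Hs; evar_last.
  - apply is_derive_RInt_param.
    + generalize (Hloc s Hs); apply filter_imp; intros x Hx t _.
      eexists; now apply HD.
    + intros t _.
      apply (continuity_2d_pt_ext_loc D).
      * apply locally_2d_locally.
        assert (K : locally (s, t) (fun p : R * R => -1 < fst p < 1)).
        { exact (continuous_fst s t _ (Hloc s Hs)). }
        revert K; apply filter_imp; intros [x y] Hx; simpl in *; symmetry.
        now apply is_derive_unique, HD.
      * apply continuity_2d_pt_filterlim, CD, Hs.
    + generalize (Hloc s Hs); apply filter_imp; intros x Hx.
      exact (proj1 (ex_RInt_circle h x 0 (2 * PI) Ch Hx)).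
  - apply RInt_ext; intros t _; now apply is_derive_unique, HD. }
(* [s * D s t] is the angular derivative of [Im h], so its integral is an increment around a closed
   circle, which is 0; [s > 0] allows division by [s]. *)
assert (HD0 : forall s, 0 < s < 1 -> RInt (D s) 0 (2 * PI) = 0).
{ intros s Hs.
  assert (K : is_RInt (fun t => s * D s t) 0 (2 * PI)
    (minus (snd (h (circle s (2 * PI)))) (snd (h (circle s 0))))).
  { apply (is_RInt_derive (V := R_CompleteNormedModule) (fun t => snd (h (circle s t)))).
    - intros t _; apply is_derive_circle_angle, Hh, circle_in_disk; lra.
    - intros t _; apply (continuous_mult (K := R_AbsRing)); [apply continuous_const|].
      apply (continuous_comp_2 (fun _ => s) (fun t => t) D);
        [apply continuous_const|apply continuous_id|apply CD; lra]. }
  apply (is_RInt_unique (V := R_CompleteNormedModule)) in K.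
  replace (circle s (2 * PI)) with (circle s 0) in K
    by (unfold circle; now rewrite cos_0, sin_0, cos_2PI, sin_2PI).
  rewrite minus_eq_zero in K.
  assert (K2 : RInt (fun t => s * D s t) 0 (2 * PI) = s * RInt (D s) 0 (2 * PI)).
  { apply (RInt_scal (V := R_CompleteNormedModule) (D s) 0 (2 * PI) s).
    apply (ex_RInt_continuous (V := R_CompleteNormedModule)); intros t _.
    apply (continuous_comp_2 (fun _ => s) (fun t => t) D);
      [apply continuous_const|apply continuous_id|apply CD; lra]. }
  rewrite K2 in K; change (s * RInt (D s) 0 (2 * PI) = 0) in K.
  apply Rmult_integral in K; destruct K; trivial; lra. }
(* The intermediate radius lies strictly between 0 and [r], so [HD0] applies and the integral equals
   its value at radius 0. *)
destruct (MVT_cor2 (fun s => RInt (fun t => fst (h (circle s t))) 0 (2 * PI))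
  (fun s => RInt (D s) 0 (2 * PI)) 0 r) as [c [Hc1 Hc2]]; [lra| |].
{ intros c Hc; apply is_derive_Reals, HJ; lra. }
rewrite HD0, Rmult_0_l in Hc1 by lra.
assert (E0 : RInt (fun t => fst (h (circle 0 t))) 0 (2 * PI) = 0).
{ rewrite (RInt_ext _ (fun _ => 0)).
  - rewrite RInt_const; apply (scal_zero_r (V := R_NormedModule)).
  - intros t _; replace (circle 0 t) with (RtoC 0); [now rewrite h0|].
    unfold circle; now rewrite !Rmult_0_l. }
rewrite E0 in Hc1; lra.
Qed.

(** * Bessel's inequality for quotients of power series *)

Lemma in_disk_0 : in_disk (RtoC 0).
Proof. apply in_diskE; rewrite Cmod_0; lra. Qed.

Lemma locally_in_disk (z : C) : in_disk z -> locally (T := C_UniformSpace) z in_disk.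
Proof.
intros Hz; apply in_diskE in Hz.
assert (H : 0 < 1 - Cmod z) by lra.
apply locally_C; exists (mkposreal _ H); intros y Hy; apply in_diskE.
change (Cmod (y - z) < 1 - Cmod z) in Hy.
replace y with (z + (y - z))%C by ring.
eapply Rle_lt_trans; [apply Cmod_triangle|lra].
Qed.

Lemma power_sum_0 (a : nat -> C) (f : C -> C) : power_sum a f -> f (RtoC 0) = a 0%nat.
Proof.
intros Hf.
exact (filterlim_locally_unique (V := C_NormedModule) _ _ _ (Hf _ in_disk_0)
         (is_pseries_0 (V := C_NormedModule) a)).
Qed.

Lemma power_sum_shift (a : nat -> C) (f : C -> C) :
  power_sum a f -> exists f1, power_sum (fun n => a (S n)) f1 /\
    forall z, in_disk z -> f z = (a 0%nat + z * f1 z)%C.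
Proof.
intros Hf.
exists (fun z => if Ceq_dec z (RtoC 0) then a 1%nat else (/ z * (f z - a 0%nat))%C).
split; intros z Hz; destruct (Ceq_dec z (RtoC 0)) as [->|n].
- exact (is_pseries_0 (V := C_NormedModule) (fun n => a (S n))).
- refine (is_pseries_decr_1 (V := C_NormedModule) a z (/ z)%C (f z) _ (Hf z Hz)).
  change (/ z * z = RtoC 1)%C; field; trivial.
- rewrite (power_sum_0 a f Hf); ring.
- field; trivial.
Qed.

Lemma power_sum_minus_scal (a b : nat -> C) (f g : C -> C) (k : C) :
  power_sum a f -> power_sum b g ->
  power_sum (fun n => a n - k * b n)%C (fun z => f z - k * g z)%C.
Proof.
intros Hf Hg z Hz.
refine (is_pseries_minus (V := C_NormedModule) a (PS_scal k b) z (f z) (k * g z)%C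
          (Hf z Hz) _).
refine (is_pseries_scal (V := C_NormedModule) k b z (g z) _ (Hg z Hz)).
apply Cmult_comm.
Qed.

(* The Taylor coefficients of the quotient of [sum c_n z^n] by [sum b_n z^n],
   when [b 0 = 1]. *)
Fixpoint series_quot (b c : nat -> C) (n : nat) : C :=
  match n with
  | O => c 0%nat
  | S n => series_quot b (fun k => c (S k) - c 0%nat * b (S k))%C n
  end.

(** As [b_0 = 1], the series [N - c_0 F] vanishes at 0 and can be divided by [z]. The denominator
    [F] is kept, so the step can be repeated; the new coefficients are those in the recursion of
    [series_quot]. *)
Lemma power_sum_quot_step (b c : nat -> C) (F N : C -> C) :
  power_sum b F -> power_sum c N -> b 0%nat = RtoC 1 ->
  (forall z, in_disk z -> F z <> RtoC 0) ->
  exists N1, power_sum (fun k => c (S k) - c 0%nat * b (S k))%C N1 /\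
    forall z, in_disk z -> (N z / F z = c 0%nat + z * (N1 z / F z))%C.
Proof.
intros HF HN b0 F0.
destruct (power_sum_shift _ _ (power_sum_minus_scal _ _ _ _ (c 0%nat) HN HF)) as [N1 [H1 E1]].
exists N1; split; trivial; intros z Hz; specialize (E1 z Hz); simpl in E1.
rewrite b0 in E1.
replace (N z) with (c 0%nat * F z + (N z - c 0%nat * F z))%C by ring.
rewrite E1; field; now apply F0.
Qed.

Lemma Cmod_plus_sqr (p w : C) :
  Cmod (p + w) ^ 2 = Cmod p ^ 2 + 2 * fst (Cconj p * w)%C + Cmod w ^ 2.
Proof. rewrite !Cmod_sqr; destruct p, w; simpl; ring. Qed.

(** The cross term is twice the real part of [conj p * z * L z], which vanishes at 0, so
    [circle_mean_0] removes it. *)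
Lemma circle_mean_sqr_step (K L : C -> C) (p : C) (r : R) :
  C1_holomorphic L -> 0 < r < 1 ->
  (forall z, in_disk z -> K z = (p + z * L z)%C) ->
  RInt (fun t => Cmod (K (circle r t)) ^ 2) 0 (2 * PI) =
  2 * PI * Cmod p ^ 2 + r ^ 2 * RInt (fun t => Cmod (L (circle r t)) ^ 2) 0 (2 * PI).
Proof.
intros HL Hr E; assert (Hr' : -1 < r < 1) by lra.
assert (Hh : C1_holomorphic (fun z => Cconj p * (z * L z))%C).
{ apply C1_holomorphic_mult; [apply C1_holomorphic_const|].
  apply C1_holomorphic_mult; [apply C1_holomorphic_id|trivial]. }
assert (M := circle_mean_0 _ r Hh ltac:(cbv beta; ring) Hr).
destruct (ex_RInt_circle _ r 0 (2 * PI)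
  (fun z => C1_holomorphic_continuous _ z Hh) Hr') as [I1 _].
destruct (ex_RInt_circle _ r 0 (2 * PI)
  (fun z => C1_holomorphic_continuous _ z HL) Hr') as [_ I2].
apply (RInt_correct (V := R_CompleteNormedModule)) in I1, I2.
apply (is_RInt_unique (V := R_CompleteNormedModule)).
apply (is_RInt_ext (V := R_NormedModule) (fun t => Cmod p ^ 2
  + (2 * fst (Cconj p * (circle r t * L (circle r t)))%C
     + r ^ 2 * Cmod (L (circle r t)) ^ 2))).
- intros t _; rewrite (E _ (circle_in_disk r t Hr')), Cmod_plus_sqr.
  rewrite (Cmod_mult (circle r t)), Rpow_mult_distr, Cmod_circle.
  match goal with |- ?x = ?y => change (x = y :> R) end; ring.
- evar_last.
  + apply (is_RInt_plus (V := R_NormedModule)); [apply (is_RInt_const (V := R_NormedModule))|].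
    apply (is_RInt_plus (V := R_NormedModule));
      apply (is_RInt_scal (V := R_NormedModule)); [exact I1|exact I2].
  + rewrite M; unfold scal, plus; simpl; unfold mult; simpl; ring.
Qed.

(** Iterating [circle_mean_sqr_step] extracts one coefficient at a time, and the nonnegative mean
    left at the end is dropped. The numerator changes at each step, hence an induction over all [c]
    and [N]. *)
Lemma bessel_quot (b c : nat -> C) (F N : C -> C) (r : R) (n : nat) :
  power_sum b F -> power_sum c N -> b 0%nat = RtoC 1 ->
  (forall z, in_disk z -> F z <> RtoC 0) -> 0 < r < 1 ->
  2 * PI * sum_f_R0 (fun k => Cmod (series_quot b c k) ^ 2 * (r ^ 2) ^ k) n <=
  RInt (fun t => Cmod (N (circle r t) / F (circle r t))%C ^ 2) 0 (2 * PI).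
Proof.
intros HF HN b0 F0 Hr; revert c N HN.
assert (HPI := PI_RGT_0).
assert (good : forall c N, power_sum c N -> C1_holomorphic (fun z => N z / F z)%C).
{ intros c N HN; apply C1_holomorphic_mult; [now apply power_sum_C1 with c|].
  apply C1_holomorphic_inv; trivial; now apply power_sum_C1 with b. }
assert (pos : forall c N, power_sum c N ->
  0 <= RInt (fun t => Cmod (N (circle r t) / F (circle r t))%C ^ 2) 0 (2 * PI)).
{ intros c N HN; apply RInt_ge_0; [lra| |intros t _; apply pow2_ge_0].
  refine (proj2 (ex_RInt_circle (fun z => N z / F z)%C r 0 (2 * PI) _ _)); [|lra].
  intros z; apply C1_holomorphic_continuous, (good c N HN). }
assert (Hr2 := pow2_ge_0 r).
induction n as [|n IH]; intros c N HN;
  destruct (power_sum_quot_step b c F N HF HN b0 F0) as [N1 [HN1 E1]];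
  rewrite (circle_mean_sqr_step (fun z => N z / F z)%C (fun z => N1 z / F z)%C
             (c 0%nat) r (good _ _ HN1) Hr E1).
- simpl; specialize (pos _ _ HN1); simpl in pos; nra.
- specialize (IH _ _ HN1).
  rewrite decomp_sum by lia; simpl pred.
  replace (sum_f_R0 (fun i => Cmod (series_quot b c (S i)) ^ 2 * (r ^ 2) ^ S i) n)
    with (r ^ 2 * sum_f_R0 (fun i => Cmod (series_quot b
            (fun k => c (S k) - c 0%nat * b (S k))%C i) ^ 2 * (r ^ 2) ^ i) n).
  + simpl series_quot in *; simpl ((r ^ 2) ^ 0); nra.
  + rewrite scal_sum; apply sum_eq; intros i _; simpl; ring.
Qed.

(** On the circle of radius [r] one has [|N / F| <= B / r], so [bessel_quot] bounds the weighted sum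
    by [B^2 / r^2]; letting [r] tend to 1 from the left removes the weights. *)
Lemma bounded_quot_coeff_sqr (b c : nat -> C) (F N : C -> C) (B : R) (n : nat) :
  power_sum b F -> power_sum c N -> b 0%nat = RtoC 1 ->
  (forall z, in_disk z -> F z <> RtoC 0) ->
  (forall z, in_disk z -> Cmod (z * (N z / F z))%C <= B) ->
  sum_f_R0 (fun k => Cmod (series_quot b c k) ^ 2) n <= B ^ 2.
Proof.
intros HF HN b0 F0 HB; set (S0 := sum_f_R0 _ n).
assert (HPI := PI_RGT_0).
assert (HS0 : 0 <= S0) by (apply cond_pos_sum; intros k; apply pow2_ge_0).
assert (HC : forall z, in_disk z -> Ccontinuous (fun z => N z / F z)%C z).
{ intros z; apply C1_holomorphic_continuous, C1_holomorphic_mult;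
    [now apply power_sum_C1 with c|].
  apply C1_holomorphic_inv; trivial; now apply power_sum_C1 with b. }
(* The factor is [r^(2n)], at most each weight [r^(2k)] with [k <= n], times the [r^2] from the
   denominator of [B^2 / r^2]. *)
assert (K : forall r, 0 < r < 1 -> (r ^ 2) ^ S n * S0 <= B ^ 2).
{ intros r Hr; assert (Hr' : -1 < r < 1) by lra.
  assert (H := bessel_quot b c F N r n HF HN b0 F0 Hr).
  assert (Hr2 : 0 < r ^ 2 < 1) by nra.
  assert (H1 : RInt (fun t => Cmod (N (circle r t) / F (circle r t))%C ^ 2) 0 (2 * PI)
               <= RInt (fun _ => B ^ 2 / r ^ 2) 0 (2 * PI)).
  { apply RInt_le; [lra| |apply (ex_RInt_const (V := R_NormedModule))|].
    - exact (proj2 (ex_RInt_circle (fun z => N z / F z)%C r 0 (2 * PI) HC Hr')).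
    - intros t _; apply (proj1 (Rle_div_r _ _ (r ^ 2) (proj1 Hr2))).
      assert (H2 := HB _ (circle_in_disk r t Hr')).
      rewrite <- (Cmod_circle r t), Rmult_comm, <- Rpow_mult_distr, <- Cmod_mult.
      apply pow_incr; split; [apply Cmod_ge_0|trivial]. }
  rewrite (RInt_const (V := R_CompleteNormedModule)) in H1.
  change (RInt (fun t => Cmod (N (circle r t) / F (circle r t))%C ^ 2) 0 (2 * PI)
          <= (2 * PI - 0) * (B ^ 2 / r ^ 2)) in H1.
  assert (H3 : (r ^ 2) ^ n * S0 <=
    sum_f_R0 (fun k => Cmod (series_quot b c k) ^ 2 * (r ^ 2) ^ k) n).
  { unfold S0; rewrite scal_sum; apply sum_Rle; intros k Hk.
    apply Rmult_le_compat_l; [apply pow2_ge_0|].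
    replace n with (k + (n - k))%nat by lia; rewrite pow_add.
    assert (K1 : 0 <= (r ^ 2) ^ k) by (apply pow_le; lra).
    assert (K2 : (r ^ 2) ^ (n - k) <= 1) by (rewrite <- (pow1 (n - k)); apply pow_incr; lra).
    nra. }
  assert (H4 : sum_f_R0 (fun k => Cmod (series_quot b c k) ^ 2 * (r ^ 2) ^ k) n
               <= B ^ 2 / r ^ 2).
  { apply Rmult_le_reg_l with (2 * PI); [lra|].
    apply Rle_trans with (1 := H), Rle_trans with (1 := H1), Req_le; ring. }
  apply Rle_div_r in H4; [|lra].
  simpl pow at 1; change (r * (r * 1)) with (r ^ 2); nra. }
refine (filterlim_le (F := at_left 1) (fun r => (r ^ 2) ^ S n * S0) (fun _ => B ^ 2)
          S0 (B ^ 2) _ _ (filterlim_const _)).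
- assert (H : locally 1 (fun r => 0 < r)) by (apply open_gt; lra).
  exact (filter_imp _ _ (fun r H0 H1 => K r (conj H0 H1)) H).
- assert (Hc : continuous (fun r => (r ^ 2) ^ S n * S0) 1).
  { apply (ex_derive_continuous (V := R_NormedModule)); auto_derive; trivial. }
  unfold continuous in Hc; rewrite !pow1, Rmult_1_l in Hc.
  exact (filterlim_filter_le_1 _ (filter_le_within _) Hc).
Qed.

(** * The range of the inverse hyperbolic sine *)

(** If [8/5 <= pi/2], then [cos (8/5) >= 0], yet its upper bound [1 - x^2/2 + x^4/24] is about
    -0.007 at [x = 8/5]. *)
Lemma PI2_lt_8_5 : PI / 2 < 8 / 5.
Proof.
apply Rnot_le_lt; intros H.
assert (H0 : 0 <= cos (8 / 5)) by (apply cos_ge_0; lra).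
destruct (cos_bound (8 / 5) 0) as [_ H1]; [lra|trivial|].
unfold cos_approx, cos_term in H1; simpl in H1; lra.
Qed.

(** From [sinh (x + i y) = sinh x cos y + i cosh x sin y] and [cosh^2 = 1 + sinh^2]. *)
Lemma Cmod_csinh_sqr (x y : R) : Cmod (csinh (x, y)) ^ 2 = sinh x ^ 2 + sin y ^ 2.
Proof.
rewrite Cmod_sqr.
replace (csinh (x, y)) with ((sinh x * cos y, cosh x * sin y) : C).
- simpl fst; simpl snd.
  assert (H := sin2_cos2_pow y).
  assert (E : cosh x ^ 2 = 1 + sinh x ^ 2).
  { unfold cosh, sinh; rewrite exp_Ropp; field; apply Rgt_not_eq, exp_pos. }
  replace (cos y ^ 2) with (1 - sin y ^ 2) by lra.
  rewrite !Rpow_mult_distr, E.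
  replace (cos y ^ 2) with (1 - sin y ^ 2) by lra; ring.
- unfold csinh, cexp, sinh, cosh; simpl.
  rewrite cos_neg, sin_neg.
  change (((exp x - exp (- x)) / 2 * cos y, (exp x + exp (- x)) / 2 * sin y) =
    Cmult (Cminus (exp x * cos y, exp x * sin y)
                  (exp (- x) * cos y, exp (- x) * - sin y)) (Cinv (RtoC 2))).
  unfold Cminus, Cplus, Copp, Cmult, Cinv, RtoC; simpl; f_equal; field.
Qed.

(** By the mean value theorem [sinh t >= t] for [t >= 0], since [cosh >= 1]; oddness gives the
    negative side. *)
Lemma sqr_le_sinh_sqr (x : R) : x ^ 2 <= sinh x ^ 2.
Proof.
assert (H : forall t, 0 <= t -> t <= sinh t).
{ intros t Ht.
  destruct (Req_dec t 0) as [->|Ht0]; [rewrite sinh_0; lra|].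
  destruct (MVT_cor2 sinh cosh 0 t) as [c [Hc1 Hc2]]; [lra| |].
  - intros c _; apply derivable_pt_lim_sinh.
  - rewrite sinh_0 in Hc1.
    assert (1 <= cosh c).
    { unfold cosh; assert (K1 := exp_ineq1_le c); assert (K2 := exp_ineq1_le (- c)); lra. }
    nra. }
destruct (Rle_dec 0 x) as [Hx|Hx].
- specialize (H x Hx); nra.
- assert (K := H (- x) ltac:(lra)).
  assert (E : sinh (- x) = - sinh x) by (unfold sinh; rewrite Ropp_involutive; field).
  rewrite E in K; nra.
Qed.

Lemma csinh_small_bound (u : C) :
  Cmod (csinh u) < 1 -> Rabs (snd u) <= PI / 2 -> Cmod u <= 8 / 5.
Proof.
intros H1 H2; destruct u as [x y]; simpl in H2.
assert (H0 := Cmod_ge_0 (csinh (x, y))).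
assert (H3 := Cmod_csinh_sqr x y); assert (H4 := sqr_le_sinh_sqr x).
assert (H5 := Cmod_sqr (x, y)); simpl fst in H5; simpl snd in H5.
assert (H6 := sin2_cos2_pow y); assert (H7 := Cmod_ge_0 (x, y)).
assert (HP := PI2_lt_8_5); assert (HP0 := PI_RGT_0).
(* [x^2 < cos^2 y = sin^2 t <= t^2 <= (pi/2)^2 - y^2] with [t = pi/2 - |y|]. *)
assert (H8 : cos y ^ 2 <= (PI / 2 - Rabs y) ^ 2).
{ replace (cos y) with (sin (PI / 2 - Rabs y)).
  - assert (K0 : 0 <= PI / 2 - Rabs y) by lra.
    assert (K1 : 0 <= sin (PI / 2 - Rabs y)).
    { apply sin_ge_0; [trivial|]; generalize (Rabs_pos y); lra. }
    assert (K2 : sin (PI / 2 - Rabs y) <= PI / 2 - Rabs y).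
    { destruct (Rle_lt_or_eq_dec _ _ K0) as [K|<-]; [left; now apply sin_lt_x|].
      rewrite sin_0; lra. }
    nra.
  - rewrite sin_shift; unfold Rabs; destruct (Rcase_abs y); trivial; apply cos_neg. }
assert (H9 := Rabs_pos y); rewrite <- (pow2_abs y) in H5; nra.
Qed.

(** If [|Im u|] exceeded [pi/2] at [z], it would equal [pi/2] somewhere on the segment from 0 to
    [z]. There [sin^2 (Im u) = 1], so [|sinh u| >= 1] by [Cmod_csinh_sqr], a contradiction. *)
Lemma asinh_branch_bound (u : C -> C) :
  (forall z, in_disk z -> Ccontinuous u z) -> u (RtoC 0) = RtoC 0 ->
  (forall z, in_disk z -> Cmod (csinh (u z)) < 1) ->
  forall z, in_disk z -> Cmod (u z) <= 8 / 5.
Proof.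
intros Hc u0 Hs z Hz.
apply csinh_small_bound; [now apply Hs|].
apply Rnot_lt_le; intros Hy.
assert (HP0 := PI_RGT_0).
assert (Hin : forall t, 0 <= t <= 1 -> in_disk (RtoC t * z)%C).
{ intros t Ht; apply in_diskE; apply in_diskE in Hz.
  rewrite Cmod_mult, Cmod_R, Rabs_pos_eq by lra; assert (H := Cmod_ge_0 z); nra. }
destruct (IVT_interv (fun t => Rabs (snd (u (RtoC t * z)%C)) - PI / 2) 0 1) as [t [Ht Et]].
- intros t Ht; apply continuity_pt_filterlim.
  change (continuous (fun t => Rabs (snd (u (RtoC t * z)%C)) - PI / 2) t).
  apply (continuous_minus (V := R_NormedModule)); [|apply continuous_const].
  apply (continuous_comp (fun t => snd (u (RtoC t * z)%C)) Rabs); [|apply continuous_Rabs].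
  apply (fun H => proj2 (proj1 (Ccontinuous_components
    (fun t => u (RtoC t * z)%C) t) H)).
  apply (continuous_comp (V := C_UniformSpace) (W := C_UniformSpace)
           (fun t => RtoC t * z)%C u); [|now apply Hc, Hin].
  apply Ccontinuous_mult; [|apply continuous_const].
  apply Ccontinuous_components; split; [apply continuous_id|apply continuous_const].
- lra.
- rewrite Cmult_0_l, u0; simpl; rewrite Rabs_R0; lra.
- rewrite Cmult_1_l; lra.
- specialize (Hs _ (Hin t Ht)); destruct (u (RtoC t * z)%C) as [x y]; simpl in Et.
  assert (H1 := Cmod_csinh_sqr x y); assert (H2 := Cmod_ge_0 (csinh (x, y))).
  assert (H3 := pow2_ge_0 (sinh x)).
  assert (H4 : sin y ^ 2 = 1).
  { unfold Rabs in Et; destruct (Rcase_abs y).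
    - replace y with (- (PI / 2)) by lra; rewrite sin_neg, sin_PI2; ring.
    - replace y with (PI / 2) by lra; rewrite sin_PI2; ring. }
  nra.
Qed.

(** * The Hankel determinant *)

Section HankelDeterminant.

Import all_boot all_algebra complex Rstruct ring GRing.Theory.
Local Open Scope ring_scope.

(** [toRi] respects the ring operations and has left inverse [ofRi], so the determinant formula over
    [R[i]] carries back to [C]. *)
Lemma toRiD (x y : C) : toRi (Cplus x y) = toRi x + toRi y.
Proof. by case: x y => [x1 x2] [y1 y2]. Qed.

Lemma toRiN (x : C) : toRi (Copp x) = - toRi x.
Proof. by case: x. Qed.

Lemma toRiM (x y : C) : toRi (Cmult x y) = toRi x * toRi y.
Proof. by case: x y => [x1 x2] [y1 y2]. Qed.

Lemma toRiK (x : C) : ofRi (toRi x) = x.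
Proof. by case: x. Qed.

(** Laplace expansion along the first row, three times over, leaves minors of size 1. *)
Lemma det_hankel4 (K : comNzRingType) (a : nat -> K) :
  \det (\matrix_(i < 4, j < 4) a (nat_of_ord i + nat_of_ord j + 1)%N) =
  a 1 * (a 3 * (a 5 * a 7 - a 6 * a 6) - a 4 * (a 4 * a 7 - a 5 * a 6)
         + a 5 * (a 4 * a 6 - a 5 * a 5))
  - a 2 * (a 2 * (a 5 * a 7 - a 6 * a 6) - a 4 * (a 3 * a 7 - a 4 * a 6)
         + a 5 * (a 3 * a 6 - a 4 * a 5))
  + a 3 * (a 2 * (a 4 * a 7 - a 5 * a 6) - a 3 * (a 3 * a 7 - a 4 * a 6)
         + a 5 * (a 3 * a 5 - a 4 * a 4))
  - a 4 * (a 2 * (a 4 * a 6 - a 5 * a 5) - a 3 * (a 3 * a 6 - a 4 * a 5)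
         + a 4 * (a 3 * a 5 - a 4 * a 4)).
Proof.
rewrite (expand_det_row _ ord0) !(big_ord_recl, big_ord0) /cofactor.
rewrite !(expand_det_row _ ord0) !(big_ord_recl, big_ord0) /cofactor.
rewrite !(expand_det_row _ ord0) !(big_ord_recl, big_ord0) /cofactor.
rewrite !det_mx11 !mxE /= /bump /=.
ring.
Qed.

Local Close Scope ring_scope.
Local Open Scope C_scope.

Lemma H41E (a : nat -> C) :
  H41 a =
  a 1%N * (a 3%N * (a 5%N * a 7%N - a 6%N * a 6%N) - a 4%N * (a 4%N * a 7%N - a 5%N * a 6%N)
          + a 5%N * (a 4%N * a 6%N - a 5%N * a 5%N))
   - a 2%N * (a 2%N * (a 5%N * a 7%N - a 6%N * a 6%N) - a 4%N * (a 3%N * a 7%N - a 4%N * a 6%N)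
          + a 5%N * (a 3%N * a 6%N - a 4%N * a 5%N))
   + a 3%N * (a 2%N * (a 4%N * a 7%N - a 5%N * a 6%N) - a 3%N * (a 3%N * a 7%N - a 4%N * a 6%N)
          + a 5%N * (a 3%N * a 5%N - a 4%N * a 4%N))
   - a 4%N * (a 2%N * (a 4%N * a 6%N - a 5%N * a 5%N) - a 3%N * (a 3%N * a 6%N - a 4%N * a 5%N)
          + a 4%N * (a 3%N * a 5%N - a 4%N * a 4%N)).
Proof.
rewrite /H41 (det_hankel4 _ (fun n => toRi (a n))) -[RHS]toRiK /Cminus.
by rewrite !(toRiD, toRiM, toRiN).
Qed.

End HankelDeterminant.

(* The scaling factor is the common denominator of the expansion. *)
Lemma hankel_expansion (a2 a3 a4 a5 a6 a7 p1 p2 p3 p4 p5 p6 : C) :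
  (a2 = p1 ->
  2 * a3 = p2 + p1 * a2 ->
  3 * a4 = p3 + p2 * a2 + p1 * a3 ->
  4 * a5 = p4 + p3 * a2 + p2 * a3 + p1 * a4 ->
  5 * a6 = p5 + p4 * a2 + p3 * a3 + p2 * a4 + p1 * a5 ->
  6 * a7 = p6 + p5 * a2 + p4 * a3 + p3 * a4 + p2 * a5 + p1 * a6 ->
  1036800 *
  (1 * (a3 * (a5 * a7 - a6 * a6) - a4 * (a4 * a7 - a5 * a6) + a5 * (a4 * a6 - a5 * a5))
   - a2 * (a2 * (a5 * a7 - a6 * a6) - a4 * (a3 * a7 - a4 * a6) + a5 * (a3 * a6 - a4 * a5))
   + a3 * (a2 * (a4 * a7 - a5 * a6) - a3 * (a3 * a7 - a4 * a6) + a5 * (a3 * a5 - a4 * a4))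
   - a4 * (a2 * (a4 * a6 - a5 * a5) - a3 * (a3 * a6 - a4 * a5) + a4 * (a3 * a5 - a4 * a4))) =
  21600 * (p2 * p4 * p6) - 20736 * (p2 * p5 ^ 2) - 19200 * (p3 ^ 2 * p6)
   + 34560 * (p3 * p4 * p5) - 16200 * (p4 ^ 3) - 21600 * (p1 ^ 2 * p4 * p6)
   + 20736 * (p1 ^ 2 * p5 ^ 2) + 28800 * (p1 * p2 * p3 * p6)
   - 25920 * (p1 * p2 * p4 * p5) - 23040 * (p1 * p3 ^ 2 * p5)
   + 21600 * (p1 * p3 * p4 ^ 2) - 10800 * (p2 ^ 3 * p6) + 17280 * (p2 ^ 2 * p3 * p5)
   + 8100 * (p2 ^ 2 * p4 ^ 2) - 21600 * (p2 * p3 ^ 2 * p4) + 6400 * (p3 ^ 4)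
   + 9600 * (p1 ^ 3 * p3 * p6) - 8640 * (p1 ^ 3 * p4 * p5)
   - 10800 * (p1 ^ 2 * p2 ^ 2 * p6) + 16200 * (p1 ^ 2 * p2 * p4 ^ 2)
   - 7200 * (p1 ^ 2 * p3 ^ 2 * p4) + 12960 * (p1 * p2 ^ 3 * p5)
   - 21600 * (p1 * p2 ^ 2 * p3 * p4) + 9600 * (p1 * p2 * p3 ^ 3) - 1350 * (p2 ^ 4 * p4)
   + 1200 * (p2 ^ 3 * p3 ^ 2) + 3600 * (p1 ^ 4 * p2 * p6) - 5760 * (p1 ^ 4 * p3 * p5)
   + 2700 * (p1 ^ 4 * p4 ^ 2) - 4320 * (p1 ^ 3 * p2 ^ 2 * p5)
   + 3200 * (p1 ^ 3 * p3 ^ 3) + 5400 * (p1 ^ 2 * p2 ^ 3 * p4)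
   - 3600 * (p1 ^ 2 * p2 ^ 2 * p3 ^ 2) - 1800 * (p1 * p2 ^ 4 * p3) + 675 * (p2 ^ 6)
   - 1200 * (p1 ^ 6 * p6) + 2592 * (p1 ^ 5 * p2 * p5) + 1440 * (p1 ^ 5 * p3 * p4)
   - 2700 * (p1 ^ 4 * p2 ^ 2 * p4) - 3600 * (p1 ^ 4 * p2 * p3 ^ 2)
   + 4800 * (p1 ^ 3 * p2 ^ 3 * p3) - 1350 * (p1 ^ 2 * p2 ^ 5) + 288 * (p1 ^ 7 * p5)
   - 1080 * (p1 ^ 6 * p2 * p4) + 240 * (p1 ^ 6 * p3 ^ 2) + 720 * (p1 ^ 5 * p2 ^ 2 * p3)
   - 225 * (p1 ^ 4 * p2 ^ 4) + 90 * (p1 ^ 8 * p4) - 60 * (p1 ^ 6 * p2 ^ 3)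
   - 40 * (p1 ^ 9 * p3) + 45 * (p1 ^ 8 * p2 ^ 2) - 6 * (p1 ^ 10 * p2) + 1 * (p1 ^ 12))%C.
Proof.
(* The relations form a triangular system: each coefficient is isolated and substituted in turn,
   leaving an identity in the [p_k] alone. *)
assert (solve : forall (k : R) (u v : C), k <> 0 -> (RtoC k * u = v -> u = RtoC (/ k) * v)%C).
{ intros k u v Hk <-; rewrite Cmult_assoc, <- RtoC_mult, Rinv_l, Cmult_1_l; trivial. }
intros E2 E3 E4 E5 E6 E7.
apply solve in E3, E4, E5, E6, E7; try lra.
rewrite RtoC_inv in E3, E4, E5, E6, E7 by lra.
subst a2 a3 a4 a5 a6 a7.
field.
Qed.

(** Makes a cubic monomial linear in the squares: one factor is bounded by [M], the other two by the
    arithmetic-geometric mean inequality. *)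
Lemma cubic_le {M a b c : R} :
  0 <= a <= M -> 0 <= b <= M -> 0 <= c <= M -> a * (b * c) <= M * ((b ^ 2 + c ^ 2) / 2).
Proof.
intros Ha Hb Hc; assert (K := pow2_ge_0 (b - c)).
apply Rmult_le_compat; try lra; apply Rmult_le_pos; lra.
Qed.

(** The analogue in degree at least 4: [x^i y^j] collects the surplus factors, and the result is
    linear in products of two squares. *)
Lemma monomial_le {M x y a b c d : R} (i j : nat) : 0 <= x <= M -> 0 <= y <= M ->
  0 <= a <= M -> 0 <= b <= M -> 0 <= c <= M -> 0 <= d <= M ->
  x ^ i * y ^ j * (a * b * (c * d)) <=
  M ^ i * M ^ j * ((a ^ 2 * b ^ 2 + c ^ 2 * d ^ 2) / 2).
Proof.
intros Hx Hy Ha Hb Hc Hd; apply Rmult_le_compat.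
- apply Rmult_le_pos; apply pow_le; lra.
- repeat apply Rmult_le_pos; lra.
- apply Rmult_le_compat; try (apply pow_le; lra); apply pow_incr; lra.
- assert (K := pow2_ge_0 (a * b - c * d)); nra.
Qed.

(* After bounding surplus factors by 8/5, each monomial of degree at least 4 is
   split as [(x_a x_b) (x_c x_d)]; the splittings come from a numerical search
   that keeps the coefficients of all [x_i^2 x_j^2] in the result small. *)
Lemma hankel_majorant (x1 x2 x3 x4 x5 x6 : R) :
  0 <= x1 -> 0 <= x2 -> 0 <= x3 -> 0 <= x4 -> 0 <= x5 -> 0 <= x6 ->
  x1 ^ 2 + x2 ^ 2 + x3 ^ 2 + x4 ^ 2 + x5 ^ 2 + x6 ^ 2 <= (8 / 5) ^ 2 ->
  21600 * (x2 * x4 * x6) + 20736 * (x2 * x5 ^ 2) + 19200 * (x3 ^ 2 * x6)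
   + 34560 * (x3 * x4 * x5) + 16200 * (x4 ^ 3) + 21600 * (x1 ^ 2 * x4 * x6)
   + 20736 * (x1 ^ 2 * x5 ^ 2) + 28800 * (x1 * x2 * x3 * x6)
   + 25920 * (x1 * x2 * x4 * x5) + 23040 * (x1 * x3 ^ 2 * x5)
   + 21600 * (x1 * x3 * x4 ^ 2) + 10800 * (x2 ^ 3 * x6) + 17280 * (x2 ^ 2 * x3 * x5)
   + 8100 * (x2 ^ 2 * x4 ^ 2) + 21600 * (x2 * x3 ^ 2 * x4) + 6400 * (x3 ^ 4)
   + 9600 * (x1 ^ 3 * x3 * x6) + 8640 * (x1 ^ 3 * x4 * x5)
   + 10800 * (x1 ^ 2 * x2 ^ 2 * x6) + 16200 * (x1 ^ 2 * x2 * x4 ^ 2)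
   + 7200 * (x1 ^ 2 * x3 ^ 2 * x4) + 12960 * (x1 * x2 ^ 3 * x5)
   + 21600 * (x1 * x2 ^ 2 * x3 * x4) + 9600 * (x1 * x2 * x3 ^ 3) + 1350 * (x2 ^ 4 * x4)
   + 1200 * (x2 ^ 3 * x3 ^ 2) + 3600 * (x1 ^ 4 * x2 * x6) + 5760 * (x1 ^ 4 * x3 * x5)
   + 2700 * (x1 ^ 4 * x4 ^ 2) + 4320 * (x1 ^ 3 * x2 ^ 2 * x5)
   + 3200 * (x1 ^ 3 * x3 ^ 3) + 5400 * (x1 ^ 2 * x2 ^ 3 * x4)
   + 3600 * (x1 ^ 2 * x2 ^ 2 * x3 ^ 2) + 1800 * (x1 * x2 ^ 4 * x3) + 675 * (x2 ^ 6)
   + 1200 * (x1 ^ 6 * x6) + 2592 * (x1 ^ 5 * x2 * x5) + 1440 * (x1 ^ 5 * x3 * x4)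
   + 2700 * (x1 ^ 4 * x2 ^ 2 * x4) + 3600 * (x1 ^ 4 * x2 * x3 ^ 2)
   + 4800 * (x1 ^ 3 * x2 ^ 3 * x3) + 1350 * (x1 ^ 2 * x2 ^ 5) + 288 * (x1 ^ 7 * x5)
   + 1080 * (x1 ^ 6 * x2 * x4) + 240 * (x1 ^ 6 * x3 ^ 2) + 720 * (x1 ^ 5 * x2 ^ 2 * x3)
   + 225 * (x1 ^ 4 * x2 ^ 4) + 90 * (x1 ^ 8 * x4) + 60 * (x1 ^ 6 * x2 ^ 3)
   + 40 * (x1 ^ 9 * x3) + 45 * (x1 ^ 8 * x2 ^ 2) + 6 * (x1 ^ 10 * x2) + 1 * (x1 ^ 12)
  <= 1036800 * (428001 / 1000000).
Proof.
intros P1 P2 P3 P4 P5 P6 HS.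
assert (B1 : 0 <= x1 <= 8 / 5) by nra; assert (B2 : 0 <= x2 <= 8 / 5) by nra.
assert (B3 : 0 <= x3 <= 8 / 5) by nra; assert (B4 : 0 <= x4 <= 8 / 5) by nra.
assert (B5 : 0 <= x5 <= 8 / 5) by nra; assert (B6 : 0 <= x6 <= 8 / 5) by nra.
(* One instance per monomial, in the order of the statement. *)
generalize (cubic_le B4 B2 B6) (cubic_le B5 B2 B5) (cubic_le B3 B3 B6)
  (cubic_le B4 B3 B5) (cubic_le B4 B4 B4) (monomial_le 0 0 B1 B2 B1 B4 B1 B6)
  (monomial_le 0 0 B1 B2 B1 B5 B1 B5) (monomial_le 0 0 B1 B2 B1 B6 B2 B3)
  (monomial_le 0 0 B1 B2 B1 B5 B2 B4) (monomial_le 0 0 B1 B2 B1 B3 B3 B5)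
  (monomial_le 0 0 B1 B2 B1 B4 B3 B4) (monomial_le 0 0 B1 B2 B2 B2 B2 B6)
  (monomial_le 0 0 B1 B2 B2 B3 B2 B5) (monomial_le 0 0 B1 B2 B2 B4 B2 B4)
  (monomial_le 0 0 B1 B2 B2 B3 B3 B4) (monomial_le 0 0 B1 B2 B3 B3 B3 B3)
  (monomial_le 1 0 B1 B2 B1 B3 B1 B6) (monomial_le 1 0 B1 B2 B1 B4 B1 B5)
  (monomial_le 1 0 B1 B2 B1 B2 B2 B6) (monomial_le 1 0 B1 B2 B1 B4 B2 B4)
  (monomial_le 1 0 B1 B2 B1 B3 B3 B4) (monomial_le 0 1 B1 B2 B1 B2 B2 B5)
  (monomial_le 1 0 B1 B2 B2 B2 B3 B4) (monomial_le 1 0 B1 B2 B2 B3 B3 B3)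
  (monomial_le 0 1 B1 B2 B2 B2 B2 B4) (monomial_le 0 1 B1 B2 B2 B3 B2 B3)
  (monomial_le 2 0 B1 B2 B1 B2 B1 B6) (monomial_le 2 0 B1 B2 B1 B3 B1 B5)
  (monomial_le 2 0 B1 B2 B1 B4 B1 B4) (monomial_le 1 1 B1 B2 B1 B1 B2 B5)
  (monomial_le 2 0 B1 B2 B1 B3 B3 B3) (monomial_le 1 1 B1 B2 B1 B2 B2 B4)
  (monomial_le 2 0 B1 B2 B2 B3 B2 B3) (monomial_le 0 2 B1 B2 B1 B3 B2 B2)
  (monomial_le 0 2 B1 B2 B2 B2 B2 B2) (monomial_le 3 0 B1 B2 B1 B1 B1 B6)
  (monomial_le 3 0 B1 B2 B1 B2 B1 B5) (monomial_le 3 0 B1 B2 B1 B3 B1 B4)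
  (monomial_le 3 0 B1 B2 B1 B2 B2 B4) (monomial_le 2 1 B1 B2 B1 B1 B3 B3)
  (monomial_le 0 3 B1 B2 B1 B1 B1 B3) (monomial_le 0 3 B1 B2 B1 B2 B1 B2)
  (monomial_le 4 0 B1 B2 B1 B1 B1 B5) (monomial_le 4 0 B1 B2 B1 B2 B1 B4)
  (monomial_le 4 0 B1 B2 B1 B3 B1 B3) (monomial_le 4 0 B1 B2 B1 B2 B2 B3)
  (monomial_le 2 2 B1 B2 B1 B2 B1 B2) (monomial_le 5 0 B1 B2 B1 B1 B1 B4)
  (monomial_le 3 2 B1 B2 B1 B1 B1 B2) (monomial_le 6 0 B1 B2 B1 B1 B1 B3)
  (monomial_le 6 0 B1 B2 B1 B2 B1 B2) (monomial_le 7 0 B1 B2 B1 B1 B1 B2)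
  (monomial_le 8 0 B1 B2 B1 B1 B1 B1).
assert (sqr : forall a b, 0 <= a ^ 2 * b ^ 2).
{ intros a b; apply Rmult_le_pos; apply pow2_ge_0. }
generalize (sqr x1 x1) (sqr x1 x2) (sqr x1 x3) (sqr x1 x4) (sqr x1 x5) (sqr x1 x6)
  (sqr x2 x2) (sqr x2 x3) (sqr x2 x4) (sqr x2 x5) (sqr x2 x6) (sqr x3 x3) (sqr x3 x4)
  (sqr x3 x5) (sqr x3 x6) (sqr x4 x4) (sqr x4 x5) (sqr x4 x6) (sqr x5 x5) (sqr x5 x6)
  (sqr x6 x6) (pow2_ge_0 x1) (pow2_ge_0 x2) (pow2_ge_0 x3) (pow2_ge_0 x4) (pow2_ge_0 x5)
  (pow2_ge_0 x6).
(* The squared constraint controls the products [x_i^2 x_j^2] as [HS] controls the [x_i^2]; with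
   monomials as atoms, what remains is a linear problem. *)
assert (HS2 : (x1 ^ 2 + x2 ^ 2 + x3 ^ 2 + x4 ^ 2 + x5 ^ 2 + x6 ^ 2) ^ 2 <= ((8 / 5) ^ 2) ^ 2).
{ apply pow_incr; split; trivial; nra. }
clear sqr P1 P2 P3 P4 P5 P6 B1 B2 B3 B4 B5 B6.
intros; lra.
Qed.

Lemma Cmod_plus_le (u v : C) (x y : R) :
  Cmod u <= x -> Cmod v <= y -> Cmod (u + v)%C <= x + y.
Proof. intros; eapply Rle_trans; [apply Cmod_triangle|lra]. Qed.

Lemma Cmod_minus_le (u v : C) (x y : R) :
  Cmod u <= x -> Cmod v <= y -> Cmod (u - v)%C <= x + y.
Proof. intros; apply Cmod_plus_le; trivial; now rewrite Cmod_opp. Qed.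

(** The relations compare coefficients in [z f' = f (1 + u)]: [(n - 1) a_n] is the sum of
    [p_k a_(n-k)] for [1 <= k < n], with [a_1 = 1]. *)
Lemma hankel_bound (a2 a3 a4 a5 a6 a7 p1 p2 p3 p4 p5 p6 : C) :
  a2 = p1 ->
  (2 * a3 = p2 + p1 * a2)%C ->
  (3 * a4 = p3 + p2 * a2 + p1 * a3)%C ->
  (4 * a5 = p4 + p3 * a2 + p2 * a3 + p1 * a4)%C ->
  (5 * a6 = p5 + p4 * a2 + p3 * a3 + p2 * a4 + p1 * a5)%C ->
  (6 * a7 = p6 + p5 * a2 + p4 * a3 + p3 * a4 + p2 * a5 + p1 * a6)%C ->
  Cmod p1 ^ 2 + Cmod p2 ^ 2 + Cmod p3 ^ 2 + Cmod p4 ^ 2 + Cmod p5 ^ 2 + Cmod p6 ^ 2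
    <= (8 / 5) ^ 2 ->
  Cmod
  (1 * (a3 * (a5 * a7 - a6 * a6) - a4 * (a4 * a7 - a5 * a6) + a5 * (a4 * a6 - a5 * a5))
   - a2 * (a2 * (a5 * a7 - a6 * a6) - a4 * (a3 * a7 - a4 * a6) + a5 * (a3 * a6 - a4 * a5))
   + a3 * (a2 * (a4 * a7 - a5 * a6) - a3 * (a3 * a7 - a4 * a6) + a5 * (a3 * a5 - a4 * a4))
   - a4 * (a2 * (a4 * a6 - a5 * a5) - a3 * (a3 * a6 - a4 * a5) + a4 * (a3 * a5 - a4 * a4)))%C
  <= 428001 / 1000000.
Proof.
intros E2 E3 E4 E5 E6 E7 HS; set (d := (_ + _ - _)%C).
apply Rmult_le_reg_l with 1036800; [lra|].
replace (1036800 * Cmod d) with (Cmod (RtoC 1036800 * d))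
  by (rewrite Cmod_mult, Cmod_R, Rabs_pos_eq; lra).
unfold d; rewrite (hankel_expansion _ _ _ _ _ _ p1 p2 p3 p4 p5 p6) by trivial.
eapply Rle_trans; [|apply (hankel_majorant (Cmod p1) (Cmod p2) (Cmod p3) (Cmod p4)
  (Cmod p5) (Cmod p6)); trivial; apply Cmod_ge_0].
(* The majorant has the same shape with all signs positive, so the triangle inequality matches the
   monomials one by one. *)
repeat lazymatch goal with
  | |- Cmod (_ - _)%C <= _ => apply Cmod_minus_le
  | |- Cmod (_ + _)%C <= _ => apply Cmod_plus_le
  end; rewrite !Cmod_mult, ?Cmod_pow, Cmod_R, Rabs_pos_eq; lra.
Qed.

(** * Application to the functions of the class *)

Theorem theorem3p2 (g : C -> C) (f : C -> C) (a : nat -> C) :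
  is_principal_asinh g -> in_S_rho g f a ->
  (Cmod (H41 a) <= 428001 / 1000000)%R.
Proof.
intros [_ [_ Hsinh]] (a0 & a1 & Hf & Huniv & phi & Hphi & phi0 & Hder & w & _ & _ & Hw & Hsub).
destruct (power_sum_shift a f Hf) as [F [HF Ef]].
destruct (power_sum_cderiv _ F HF) as [HN HdF].
set (b := fun n => a (S n)) in *; set (c := Cps_derive b) in *; set (N := C_derive F) in *.
assert (F_0 : F (RtoC 0) = RtoC 1) by (rewrite (power_sum_0 b F HF); exact a1).
assert (Ef' : forall z, in_disk z -> f z = (z * F z)%C)
  by (intros z Hz; rewrite (Ef z Hz), a0; ring).
(* A zero of [F] is a zero of [f = z F], hence equals 0 by univalence, but [F 0 = 1]. *)
assert (F_neq_0 : forall z, in_disk z -> F z <> RtoC 0).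
{ intros z Hz Hz0.
  assert (z = RtoC 0).
  { apply Huniv; trivial; [apply in_disk_0|].
    rewrite !Ef', Hz0 by (trivial; apply in_disk_0); ring. }
  subst z; rewrite F_0 in Hz0; injection Hz0; lra. }
(* Away from 0, divide [z (F + z N) = z F phi] by [z F]; at 0 the normalisation [phi 0 = 1] takes
   over. *)
assert (Hu : forall z, in_disk z -> (phi z - RtoC 1 = z * (N z / F z))%C).
{ intros z Hz.
  destruct (Ceq_dec z (RtoC 0)) as [->|Hz0]; [rewrite phi0; ring|].
  assert (Hd : cderiv f z (RtoC 1 * F z + z * N z)%C).
  { apply (cderiv_ext_loc (fun y => y * F y)%C).
    - generalize (locally_in_disk z Hz); apply filter_imp; intros y Hy.
      symmetry; now apply Ef'.
    - apply cderiv_mult; [apply cderiv_id|now apply HdF]. }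
  assert (H := Hder z _ Hz (cderiv_is_derive _ _ _ Hd)).
  rewrite (Ef' z Hz) in H; assert (K := F_neq_0 z Hz).
  replace (phi z) with (z * F z * phi z / (z * F z))%C by (field; auto).
  rewrite <- H; field; auto. }
assert (HB : forall z, in_disk z -> Cmod (z * (N z / F z))%C <= 8 / 5).
{ intros z Hz; rewrite <- Hu by trivial; revert z Hz.
  (* Here [phi - 1] is [g] composed with [w], so its [sinh] is [w], of modulus below 1. *)
  apply (asinh_branch_bound (fun z => phi z - RtoC 1)%C).
  - intros z Hz; apply Ccontinuous_plus; [|apply continuous_const].
    now apply ex_derive_Ccontinuous, Hphi.
  - rewrite phi0; ring.
  - intros z Hz; rewrite (Hsub z Hz).
    replace (RtoC 1 + g (w z) - RtoC 1)%C with (g (w z)) by ring.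
    rewrite Hsinh by auto; now apply in_diskE, Hw. }
(* The shift by one matters: [series_quot b c k] is the coefficient [p_(k+1)] of [u], so indices 0
   to 5 give [p_1] to [p_6]. *)
assert (HS := bounded_quot_coeff_sqr b c F N (8 / 5) 5 HF HN a1 F_neq_0 HB).
simpl sum_f_R0 in HS.
rewrite H41E, a1.
(* The relations express that the quotient series times [F] is [N]; once [series_quot] is unfolded
   they are polynomial identities in the [a_n]. *)
apply (hankel_bound _ _ _ _ _ _ (series_quot b c 0) (series_quot b c 1)
  (series_quot b c 2) (series_quot b c 3) (series_quot b c 4) (series_quot b c 5));
  trivial; unfold series_quot, c, Cps_derive, b; simpl INR; rewrite ?RtoC_plus; ring.
Qed.
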